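(* Let $X_1,X_2,\dots$ be i.i.d. with ${\sf E}X_1=0$ and $0<\sigma^2={\sf E}X_1^2<\infty$, let $\lambda>0$ and let $N_\lambda$ be a Poisson random variable with parameter $\lambda$ independent of $X_1,X_2,\dots$. Then $$\Delta_\lambda\equiv\sup_x\big|{\sf P}\big(S_{N_\lambda}<x\sigma\sqrt{\lambda}\big)-\Phi(x)\big|\le\frac{1.8546}{\sigma^2}{\sf E}X_1^2\min\Big\{1,\frac{|X_1|}{\sigma\sqrt{\lambda}}\Big\}.$$
   Context: $S_N=X_1+\dots+X_N$, $S_N=0$ if $N=0$. $\Phi$ is the standard normal distribution function. *)

(* Defs.v *)
From HB Require Import structures.
From mathcomp Require Import all_boot all_order all_algebra.
From mathcomp Require Import all_classical all_reals all_analysis.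
Set Implicit Arguments. Unset Strict Implicit. Unset Printing Implicit Defensive.
Import Order.TTheory GRing.Theory Num.Theory Num.Def.
Local Open Scope classical_set_scope.
Local Open Scope ring_scope.

Definition Phi {R : realType} (x : R) : \bar R := normal_prob 0 1 `]-oo, x[.

(* Random sum S_N(w) = X_1(w) + ... + X_{N(w)}(w), with X_1, X_2, ... stored
   as X 0, X 1, ...; empty sum = 0 when N(w) = 0. *)
Definition random_sum {T : Type} {R' : nmodType} (X : nat -> T -> R') (N : T -> nat)
  : T -> R' := fun w => \sum_(i < N w) X i w.

(* Mutual independence of the family (N, X_0, X_1, X_2, ...): product rule
   for N together with every finite initial segment of the X's (which is
   equivalent to independence of the whole countable family). *)
Definition indep_N_Xs {d} {T : measurableType d} {R : realType}
  (P : probability T R) (N : T -> nat) (X : nat -> T -> R) : Prop :=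
  forall (n : nat) (A : set nat) (B : nat -> set R),
    (forall i, measurable (B i)) ->
    P (N @^-1` A `&` \bigcap_(i in `I_n) (X i @^-1` B i)) =
    (P (N @^-1` A) * \prod_(i < n) P (X i @^-1` B i))%E.

Definition ident_distr {d} {T : measurableType d} {R : realType}
  (P : probability T R) (X : nat -> T -> R) : Prop :=
  forall (i : nat) (B : set R), measurable B ->
    P (X i @^-1` B) = P (X 0%N @^-1` B).

Definition poisson_rv {d} {T : measurableType d} {R : realType}
  (P : probability T R) (lam : R) (N : T -> nat) : Prop :=
  forall k : nat, P (N @^-1` [set k]) = (poisson_pmf lam k)%:E.

(* Main.v *)
(* Stein's method, without characteristic functions. Normalise so that
   lam * E X^2 = 1, write W = S_N, let X' be a copy of X independent of W and
   L = lam * E X^2 min(1, |X|). For Poisson N,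
     E [W f(W)] = lam * E [X' f(W + X')]                                  (S)
   for every bounded f. Let f solve f' = w f + 1(w <= y) - Phi y with
   y = x + L. By (S), P(W <= x) - Phi y is lam times the expectation of
     X'^2 (1(W <= x) + W f(W) - Phi y) - X' (f(W + X') - f(W)).
   Since w f(w) is nondecreasing with oscillation at most 1, this is at most
   X'^2; it is at most |X'|^3 (|W| + 3/2) / 2 when X' < 0; and when X' > 0 it is
   positive only if x - (X' - L) < W <= x, where it is at most X' (X' - L).
   Applying (S) to truncated linear functions gives E |W| <= 1 and the
   concentration inequality P(a < W <= b) <= 5/4 (b - a + L) for L <= 3/5.
   Altogether P(W <= x) - Phi y <= 5/4 L, and Phi y - Phi x <= L / 2. This is
   the upper bound, with the constant 7/4 < 1.8546 (for L > 3/5 the claim is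
   trivial); the lower bound is the upper bound for -X. *)

Require Import Defs.
From HB Require Import structures.
From mathcomp Require Import all_boot all_order all_algebra.
From mathcomp Require Import all_classical all_reals all_analysis.
From mathcomp Require Import measurable_realfun ring lra.
Import Order.TTheory GRing.Theory Num.Theory Num.Def.
Import numFieldNormedType.Exports.
Set Implicit Arguments. Unset Strict Implicit. Unset Printing Implicit Defensive.
Local Open Scope classical_set_scope.
Local Open Scope ring_scope.

(** The shift from x to y = x + L keeps the constant small. Without it, positive steps X' would meet
    W in an interval of length X', the concentration inequality would give 5/4 (X' + L), and the
    additive L would cost a further 5/4 L after weighting by X'^2. With it the length is X' - L, the
    bound is exactly 5/4 X', and the price is only the L / 2 of Phi y - Phi x.

    The constant 5/4 arises twice. For negative steps it is (E |W| + 3/2) / 2 with E |W| <= 1, where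
    3/2 bounds the Stein solution. In the concentration inequality at most 3/5 of the unit variance
    is given away, and 1 / (2 (1 - 3/5)) = 5/4 is left. The same 3/5 is the threshold on L; it
    exceeds 1 / 1.8546, which makes larger L trivial.

    Identity (S) holds for sums of fixed length by induction, and is then averaged over the Poisson
    weights p, for which (n + 1) p (n + 1) = lam p n. Besides integrability, (S) is all that the
    analytic half knows about W. *)

Definition mfun_of d d' (T : measurableType d) (T' : measurableType d')
    (f : T -> T') (mf : measurable_fun setT f) : {mfun T >-> T'} :=
  HB.pack_for {mfun T >-> T'} f (isMeasurableFun.Build _ _ _ _ f mf).

(** * Normal distribution function and Mills ratio *)

Section normal_cdf.
Context {R : realType}.
Implicit Types (x w a b : R).

Lemma derive_ge0_le (f df : R -> R) a b : a <= b ->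
  (forall x, a <= x <= b -> is_derive x 1 f (df x)) ->
  (forall x, a <= x <= b -> 0 <= df x) -> f a <= f b.
Proof.
move=> ab fdf df0.
have [|x xab|c cab fE] := @MVT_segment R f df a b ab.
- by move=> x /[!in_itv] /andP[ax xb]; apply: fdf; rewrite !ltW.
- apply: derivable_within_continuous xab => y /[!in_itv] yab.
  by have [] := fdf y yab.
- by rewrite -subr_ge0 fE mulr_ge0 ?subr_ge0// df0//; move: cab; rewrite in_itv.
Qed.

Definition npdf x : R := normal_pdf 0 1 x.
Definition ncdf x : R := fine (Phi x).

Lemma npdfE x : npdf x = normal_peak 1 * expR (- x ^+ 2 / 2).
Proof. by rewrite /npdf normal_pdfE ?oner_neq0// /normal_fun subr0 expr1n. Qed.

Lemma npdf_gt0 x : 0 < npdf x.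
Proof. by rewrite npdfE mulr_gt0 ?expR_gt0// normal_peak_gt0 ?oner_neq0. Qed.

Lemma npdfN x : npdf (- x) = npdf x.
Proof. by rewrite !npdfE sqrrN. Qed.

(** Follows from 2 <= pi < 4. The upper value becomes the Lipschitz constant 1/2 of [ncdf], the
    lower one the bound 3/2 on the Stein solution. *)
Lemma normal_peak1 : 1 / 3 <= normal_peak 1 :> R /\ normal_peak 1 <= 1 / 2 :> R.
Proof.
rewrite /normal_peak expr1n !mul1r.
have pi2 : (2 : R) <= pi := pi_ge2 R.
have pi4 : (pi : R) < 4 by have := pihalf_lt2 R; lra.
have s0 : 0 <= sqrtr (pi *+ 2 : R) by exact: sqrtr_ge0.
have sq : sqrtr (pi *+ 2 : R) ^+ 2 = 2 * pi.
  by rewrite sqr_sqrtr ?mulr2n; lra.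
have s2 : 2 <= sqrtr (pi *+ 2 : R) by rewrite leNgt; apply/negP => h; nra.
have s3 : sqrtr (pi *+ 2 : R) <= 3 by rewrite leNgt; apply/negP => h; nra.
by split; rewrite lef_pV2 ?posrE//; lra.
Qed.

Lemma npdf_le x : npdf x <= 1 / 2.
Proof.
have [_] := normal_peak1; apply: le_trans.
by rewrite /npdf normal_pdf_ub// oner_neq0.
Qed.

Lemma is_derive_fun_mul (f g : R -> R) x df dg :
  is_derive x 1 f df -> is_derive x 1 g dg ->
  is_derive x 1 (fun y => f y * g y) (df * g x + f x * dg).
Proof.
by move=> ? ?; apply: is_derive_eq; rewrite /GRing.scale/= addrC (mulrC (g x)).
Qed.

Lemma is_derive_npdf x : is_derive x 1 npdf (- x * npdf x).
Proof.
rewrite (_ : npdf = (fun x => normal_peak 1 * expR (- x ^+ 2 / 2))); last first.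
  by apply/funext => y; rewrite npdfE.
have h : is_derive x 1 (fun y : R => - y ^+ 2 / 2) (- x).
  apply: is_derive_eq; rewrite /GRing.scale/=; lra.
have h2 := @is_derive1_comp _ expR _ x _ _ (is_derive_expR _) h.
have := is_derive_fun_mul (is_derive_cst (normal_peak 1) x 1) h2.
by move=> /is_derive_eq; apply; rewrite /=; lra.
Qed.

Lemma PhiE x : Phi x = (ncdf x)%:E.
Proof. by rewrite /ncdf fineK// fin_num_measure. Qed.

Lemma ncdf_ge0 x : 0 <= ncdf x.
Proof. by rewrite /ncdf fine_ge0. Qed.

Lemma ncdf_le1 x : ncdf x <= 1.
Proof. by rewrite -lee_fin -PhiE probability_le1. Qed.

Lemma measurable_npdf_EFin (A : set R) :
  measurable_fun A (fun x => (npdf x)%:E).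
Proof.
by apply: measurable_funTS; apply/measurable_EFinP; exact: measurable_normal_pdf.
Qed.

Lemma is_derive_ncdf x : is_derive x 1 ncdf (npdf x).
Proof.
(* [Phi] integrates over an open half-line, the fundamental theorem of calculus below over a closed
   one. *)
have nE : ncdf = (fun y => \int[lebesgue_measure]_(t in `]-oo, y]) (npdf t)).
  apply/funext => y; rewrite /ncdf /Phi /normal_prob /Rintegral.
  by rewrite integral_itv_bndo_bndc//; exact: measurable_npdf_EFin.
rewrite nE.
have fi : lebesgue_measure.-integrable [set` Interval -oo%O (BRight (x + 1))]
    (EFin \o (npdf : R -> R)).
  by apply: integrableS (integrable_normal_pdf 0 1).
have fc : {for x, continuous (@npdf)}.
  by apply: continuous_normal_pdf; rewrite oner_neq0.
have xx1 : x < x + 1 by rewrite ltrDl.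
have [D1 D2] := continuous_FTC1 xx1 fi (ltNyr _) fc.
by apply: DeriveDef; [exact: D1|rewrite -derive1E; exact: D2].
Qed.

Lemma ncdf_le a b : a <= b -> ncdf a <= ncdf b.
Proof.
move=> ab; apply: (@derive_ge0_le _ npdf) => // x _.
- exact: is_derive_ncdf.
- exact/ltW/npdf_gt0.
Qed.

Lemma ncdf_lip a b : a <= b -> ncdf b - ncdf a <= (b - a) / 2.
Proof.
move=> ab; suff : a / 2 - ncdf a <= b / 2 - ncdf b by lra.
apply: (@derive_ge0_le (fun x => x / 2 - ncdf x) (fun x => 1 / 2 - npdf x)) => // x _.
- have := is_derive_ncdf x => h; apply: is_derive_eq.
  by rewrite /GRing.scale/=; lra.
- by have := npdf_le x; lra.
Qed.

Let idRV : {RV normal_prob (0 : R) 1 >-> R} := @mfun_of _ _ (measurableTypeR R) R id (@measurable_id _ _ setT).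

Let ncdf_cdf : ncdf = fine \o cdf idRV.
Proof.
apply/funext => x; rewrite /ncdf /= /cdf /distribution /pushforward preimage_id.
by rewrite /Phi /normal_prob integral_itv_bndo_bndc//; exact: measurable_npdf_EFin.
Qed.

Lemma cvg_ncdfNy : ncdf x @[x --> -oo] --> (0 : R).
Proof. by rewrite ncdf_cdf; exact/fine_cvg/cvg_cdfNy0. Qed.

Lemma cvg_ncdfy : ncdf x @[x --> +oo] --> (1 : R).
Proof. by rewrite ncdf_cdf; exact/fine_cvg/cvg_cdfy1. Qed.

(** As [npdf] is even, [ncdf y + ncdf (- y)] has derivative zero; its constant value is read off at
    +oo. *)
Lemma ncdfN x : ncdf (- x) = 1 - ncdf x.
Proof.
pose s y := ncdf y + ncdf (- y).
have ds (y : R) : is_derive y 1 s 0.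
  have h1 := is_derive_ncdf y.
  have hN : is_derive y 1 (fun z : R => - z) (- 1) by apply: is_derive_eq.
  have h2 := @is_derive1_comp _ ncdf _ y _ _ (is_derive_ncdf (- y)) hN.
  by apply: is_derive_eq; rewrite npdfN mulrN1 subrr.
have sc a b : a <= b -> s a = s b.
  move=> ab; apply/eqP; rewrite eq_le; apply/andP; split.
    by apply: (@derive_ge0_le _ (cst 0)).
  rewrite -lerN2; apply: (@derive_ge0_le (- s) (cst 0)) => // y _.
  by have h := ds y; apply: is_derive_eq; rewrite oppr0.
have : s y @[y --> +oo] --> (1 + 0 : R).
  by apply: cvgD; [exact: cvg_ncdfy|exact: (cvgNy_compNP ncdf _).1 cvg_ncdfNy].
have : s y @[y --> +oo] --> s x.
  apply: cvg_near_cst; near=> y.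
  by apply/esym/sc; near: y; apply: nbhs_pinfty_ge; rewrite num_real.
move=> h /(cvg_unique (@norm_hausdorff _ R)) /(_ h).
rewrite addr0 /s => h1; lra.
Unshelve. all: by end_near. Qed.

Lemma ncdf_small e w : 0 < e -> exists2 u, u <= w & ncdf u < e.
Proof.
move=> e0; have /cvgrPdist_lt /(_ e e0) h := cvg_ncdfNy.
near -oo_R => u.
exists u; first by near: u; apply: nbhs_ninfty_le; rewrite num_real.
have : `|0 - ncdf u| < e by near: u.
by rewrite sub0r normrN ger0_norm ?ncdf_ge0.
Unshelve. all: by end_near. Qed.

Lemma is_derive_fun_inv (f : R -> R) x df : f x != 0 ->
  is_derive x 1 f df -> is_derive x 1 (fun y => (f y)^-1) (- df / f x ^+ 2).
Proof.
move=> fx0 h; have := is_deriveV fx0 h => /is_derive_eq; apply.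
by rewrite /GRing.scale/=; field.
Qed.

(* [ncdf w + npdf w / w] has derivative [- npdf w / w ^+ 2] on the negative
   half-line and is asymptotically nonpositive at -oo. *)
Lemma npdf_ncdf_ge0 w : 0 <= npdf w + w * ncdf w.
Proof.
have n0 := npdf_gt0 w; have N0 := ncdf_ge0 w.
have [w0|w0] := leP 0 w; first nra.
have key u : u <= w -> ncdf w + npdf w / w <= ncdf u + npdf u / u.
  move=> uw; rewrite -lerN2.
  apply: (@derive_ge0_le (fun t => - (ncdf t + npdf t / t))
    (fun t => npdf t / t ^+ 2)) => //.
  - move=> t /andP[_ tw]; have t0 : t != 0 by lra.
    have h1 := is_derive_ncdf t.
    have h2 := is_derive_fun_mul (is_derive_npdf t) (is_derive_fun_inv t0 (is_derive_id t 1)).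
    by apply: is_derive_eq; field.
  - by move=> t _; rewrite divr_ge0 ?sqr_ge0// ltW// npdf_gt0.
suff : ncdf w + npdf w / w <= 0.
  rewrite -(@ler_nM2r _ w)// mul0r mulrDl divfK; lra.
apply/ler_addgt0Pr => e e0; have [u uw ue] := ncdf_small w e0.
apply: le_trans (key u uw) _; rewrite add0r.
have : npdf u / u <= 0.
  by rewrite mulr_ge0_le0 ?invr_le0 ?(ltW (npdf_gt0 u))//; lra.
lra.
Qed.

(* [ncdf w + w * npdf w / (1 + w ^+ 2)] has derivative
   [2 * npdf w / (1 + w ^+ 2) ^+ 2] and is asymptotically nonnegative at -oo. *)
Lemma id_npdf_ncdf_ge0 w : 0 <= w * npdf w + (1 + w ^+ 2) * ncdf w.
Proof.
have pos (t : R) : 0 < 1 + t ^+ 2 by have := sqr_ge0 t; lra.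
pose F t := ncdf t + t * npdf t / (1 + t ^+ 2).
have key u : u <= w -> F u <= F w.
  move=> uw.
  apply: (@derive_ge0_le F (fun t => 2 * npdf t / (1 + t ^+ 2) ^+ 2)) => //.
  - move=> t _; have t0 := pos t.
    have h1 := is_derive_ncdf t.
    have h3 : is_derive t 1 (fun t : R => 1 + t ^+ 2) (2 * t).
      by apply: is_derive_eq; rewrite /GRing.scale/=; lra.
    have h2 := is_derive_fun_mul (is_derive_fun_mul (is_derive_id t 1) (is_derive_npdf t))
       (@is_derive_fun_inv (fun t => 1 + t ^+ 2) t _ (lt0r_neq0 t0) h3).
    by apply: is_derive_eq; rewrite /=; field; lra.
  - by move=> t _; rewrite divr_ge0 ?sqr_ge0// mulr_ge0// ltW// npdf_gt0.
suff : 0 <= F w.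
  by rewrite -(@ler_pM2r _ (1 + w ^+ 2))// mul0r mulrDl divfK ?lt0r_neq0//; lra.
apply/ler_addgt0Pr => e e0.
(* The choice makes [e * u <= - 1]; then [u / 2], a lower bound of [u * npdf u] for negative [u], is
   at least [- e * (1 + u ^+ 2)]. *)
pose u := Num.min w (- e^-1); have ie : 0 < e^-1 by rewrite invr_gt0.
have uw : u <= w by rewrite ge_min lexx.
have ue : u <= - e^-1 by rewrite ge_min lexx orbT.
suff : - e <= F u by have := key u uw; lra.
have e1 : e * e^-1 = 1 by rewrite divff ?gt_eqF.
have n0 := npdf_gt0 u; have n1 := npdf_le u; have N0 := ncdf_ge0 u.
suff : - e <= u * npdf u / (1 + u ^+ 2) by rewrite /F; lra.
rewrite ler_pdivlMr//.
have eu : e * u <= - 1.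
  by rewrite -e1 -mulrN ler_wpM2l// ltW.
have u0 : u < 0 by lra.
have : 0 <= (e * u + 1) * u by rewrite mulr_le0//; lra.
have : u / 2 <= u * npdf u by rewrite ler_wnM2l//; lra.
nra.
Qed.

End normal_cdf.

Section mills_ratio.
Context {R : realType}.
Implicit Types (x w a b : R).

(** Mills ratio of the lower tail; the usual upper-tail ratio at [w] is [mills (- w)]. In this
    orientation it solves m' = 1 + w m, which is the Stein equation with source term 1. *)
Definition mills w : R := ncdf w / npdf w.

Lemma mills_ge0 w : 0 <= mills w.
Proof. by rewrite divr_ge0 ?ncdf_ge0// ltW// npdf_gt0. Qed.

Lemma is_derive_mills w : is_derive w 1 mills (1 + w * mills w).
Proof.
have n0 := lt0r_neq0 (npdf_gt0 w).
have := is_derive_fun_mul (is_derive_ncdf w)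
  (@is_derive_fun_inv _ npdf w _ n0 (is_derive_npdf w)).
by move=> /is_derive_eq; apply; rewrite /mills; field.
Qed.

Lemma mills_slope_ge0 w : 0 <= 1 + w * mills w.
Proof.
have n0 := npdf_gt0 w.
rewrite -(@ler_pM2r _ (npdf w))// mul0r mulrDl -mulrA divfK ?lt0r_neq0//.
by have := npdf_ncdf_ge0 w; lra.
Qed.

Lemma mills_le a b : a <= b -> mills a <= mills b.
Proof.
move=> ab; apply: (derive_ge0_le ab) => x _; first exact: is_derive_mills.
exact: mills_slope_ge0.
Qed.

(** Multiplied by [npdf x], the derivative is the expression of [id_npdf_ncdf_ge0]. *)
Lemma id_mills_le a b : a <= b -> a * mills a <= b * mills b.
Proof.
move=> ab; apply: (@derive_ge0_le _ (fun w => w * mills w)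
  (fun w => mills w + w * (1 + w * mills w))) => // x _.
  have := is_derive_fun_mul (is_derive_id x 1) (is_derive_mills x).
  by move=> /is_derive_eq; apply; rewrite mul1r.
have n0 := npdf_gt0 x.
rewrite -(@ler_pM2r _ (npdf x))// mul0r.
suff -> : (mills x + x * (1 + x * mills x)) * npdf x =
    x * npdf x + (1 + x ^+ 2) * ncdf x by exact: id_npdf_ncdf_ge0.
by rewrite /mills; field; rewrite lt0r_neq0.
Qed.

Lemma mills0 : mills 0 <= 3 / 2 :> R.
Proof.
have h : ncdf (0:R) = 1 / 2 by have := @ncdfN R 0; rewrite oppr0; lra.
have n0 := @npdf_gt0 R 0.
have [p _] := @normal_peak1 R.
rewrite /mills h ler_pdivrMr//.
have -> : npdf 0 = normal_peak 1 :> R.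
  by rewrite npdfE expr0n/= oppr0 mul0r expR0 mulr1.
lra.
Qed.

(** At [w = y] this is the agreement of the two branches of [stein]. *)
Lemma mills_reflect w : ncdf w * mills (- w) = (1 - ncdf w) * mills w.
Proof. by rewrite /mills ncdfN npdfN mulrCA mulrA. Qed.

End mills_ratio.

(** * Stein equation *)

Section stein_solution.
Context {R : realType}.
Variable y : R.
Implicit Types (x w a b u v : R).
Let p : R := ncdf y.
Let q := 1 - p.
Let p0 : 0 <= p. Proof. exact: ncdf_ge0. Qed.
Let q0 : 0 <= q. Proof. by rewrite subr_ge0 ncdf_le1. Qed.

(** The bounded solution of the Stein equation at [y]. By m' = 1 + w m for [mills], the left branch
    has derivative [w * stein w + (1 - ncdf y)] and the right branch [w * stein w - ncdf y]. *)
Definition stein w : R :=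
  if w <= y then (1 - ncdf y) * mills w else ncdf y * mills (- w).

(* The Stein equation says that this function is C^1 with derivative
   [w * stein w], although [stein] itself has a kink at [y]. *)
Definition stein_smooth w : R := stein w + ncdf y * w - Num.min w y.

Lemma stein_ler w : w <= y -> stein w = q * mills w.
Proof. by rewrite /stein => ->. Qed.

Lemma stein_geE w : y <= w -> stein w = p * mills (- w).
Proof.
rewrite le_eqVlt => /predU1P[<-|yw].
  by rewrite stein_ler// /p mills_reflect.
by rewrite /stein leNgt yw.
Qed.

Lemma stein_ge0 w : 0 <= stein w.
Proof.
by have [wy|/ltW wy] := leP w y; [rewrite stein_ler|rewrite stein_geE];
  rewrite // mulr_ge0// mills_ge0.
Qed.

Let q1 : q <= 1. Proof. by rewrite gerBl. Qed.
Let p1 : p <= 1. Proof. exact: ncdf_le1. Qed.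

(** The maximum is at [y]. For [y <= 0] it is at most [mills y <= mills 0]; for positive [y] the
    reflected expression is at most [mills (- y) <= mills 0]. *)
Lemma stein_le w : stein w <= 3 / 2.
Proof.
have m0 := @mills0 R.
have [y0|/ltW y0] := leP y 0.
  have h : q * mills y <= 3 / 2.
    by rewrite (le_trans _ m0)// (le_trans _ (mills_le y0))// ler_piMl// mills_ge0.
  have [wy|/ltW wy] := leP w y.
    by rewrite stein_ler//; apply: le_trans h; rewrite ler_wpM2l// mills_le.
  rewrite stein_geE//; apply: le_trans h.
  by rewrite -mills_reflect ler_wpM2l// mills_le// lerN2.
have h : p * mills (- y) <= 3 / 2.
  by rewrite (le_trans _ m0)// (le_trans _ (@mills_le _ (- y) 0 _)) ?oppr_le0// ler_piMl// mills_ge0.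
have [wy|/ltW wy] := leP w y.
  by rewrite stein_ler//; apply: le_trans h; rewrite mills_reflect ler_wpM2l// mills_le.
rewrite stein_geE//; apply: le_trans h.
by rewrite ler_wpM2l// mills_le// lerN2.
Qed.

Lemma id_stein_le a b : a <= b -> a * stein a <= b * stein b.
Proof.
have hl u v : u <= v -> v <= y -> u * stein u <= v * stein v.
  move=> uv vy; rewrite !stein_ler ?(le_trans uv)//.
  by rewrite !(mulrCA _ q) ler_wpM2l// id_mills_le.
have hr u v : u <= v -> y <= u -> u * stein u <= v * stein v.
  move=> uv yu; rewrite !stein_geE ?(le_trans yu)//.
  rewrite !(mulrCA _ p) ler_wpM2l//.
  by have := @id_mills_le _ (- v) (- u); rewrite lerN2 => /(_ uv); lra.
move=> ab; have [by_|/ltW yb] := leP b y; first exact: hl.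
have [ya|/ltW ay] := leP y a; first exact: hr.
by apply: (le_trans (hl _ _ ay (lexx _))); exact: hr.
Qed.

(** On the left branch this is [1 + w * mills w >= 0] times [q]; monotonicity carries it to the
    right. Paired with [id_stein_ub], it bounds the oscillation by p + q = 1. *)
Lemma id_stein_ge w : - q <= w * stein w.
Proof.
have h : forall u, u <= y -> - q <= u * stein u.
  move=> u uy; rewrite stein_ler// mulrCA.
  have := mills_slope_ge0 u; have := q0; nra.
have [wy|/ltW wy] := leP w y; first exact: h.
by apply: le_trans (id_stein_le wy); exact: h.
Qed.

Lemma id_stein_ub w : w * stein w <= p.
Proof.
have h : forall u, y <= u -> u * stein u <= p.
  move=> u uy; rewrite stein_geE// mulrCA.
  have := mills_slope_ge0 (- u); have := p0; nra.
have [wy|/ltW wy] := leP y w; first exact: h.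
by apply: le_trans (id_stein_le wy) _; exact: h.
Qed.

Lemma is_derive_stein_left v :
  is_derive v 1 (fun v => q * mills v - q * v) (q * (v * mills v)).
Proof.
have h := is_derive_mills v; apply: is_derive_eq.
by rewrite /GRing.scale/=; ring.
Qed.

Lemma is_derive_stein_right v :
  is_derive v 1 (fun v => p * mills (- v) + p * v - y) (p * (v * mills (- v))).
Proof.
have hN : is_derive v 1 (fun z : R => - z) (- 1) by apply: is_derive_eq.
have h := @is_derive1_comp _ mills _ v _ _ (is_derive_mills (- v)) hN.
apply: is_derive_eq.
by rewrite /GRing.scale/=; ring.
Qed.

(* [e = 1] bounds the increments of [stein_smooth] from below, [e = -1] from
   above. *)
Lemma stein_smooth_le (e : R) (psi dpsi : R -> R) a b : a <= b ->
  (forall t : R, is_derive t 1 psi (dpsi t)) ->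
  (forall t, a <= t <= b -> dpsi t <= e * (t * stein t)) ->
  psi b - psi a <= e * (stein_smooth b - stein_smooth a).
Proof.
move=> ab dp dple.
have hl u v : a <= u -> u <= v -> v <= b -> v <= y ->
    psi v - psi u <= e * (stein_smooth v - stein_smooth u).
  move=> au uv vb vy.
  suff : e * (q * mills u - q * u) - psi u <= e * (q * mills v - q * v) - psi v.
    rewrite /stein_smooth !stein_ler ?(le_trans uv)// -/p.
    rewrite !min_l ?(le_trans uv)// /q; lra.
  apply: (@derive_ge0_le _ (fun v => e * (q * mills v - q * v) - psi v)
    (fun v => e * (q * (v * mills v)) - dpsi v) u v uv) => t /andP[ut tv].
    have h1 := is_derive_fun_mul (is_derive_cst e t 1) (is_derive_stein_left t).
    by have h2 := dp t; apply: is_derive_eq; rewrite mul0r add0r.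
  rewrite subr_ge0 (mulrCA q) -stein_ler ?(le_trans tv)// dple//.
  by rewrite (le_trans au)// (le_trans tv).
have hr u v : a <= u -> u <= v -> v <= b -> y <= u ->
    psi v - psi u <= e * (stein_smooth v - stein_smooth u).
  move=> au uv vb yu.
  suff : e * (p * mills (- u) + p * u - y) - psi u <=
         e * (p * mills (- v) + p * v - y) - psi v.
    rewrite /stein_smooth !stein_geE ?(le_trans yu)// -/p.
    rewrite !min_r ?(le_trans yu)//; lra.
  apply: (@derive_ge0_le _ (fun v => e * (p * mills (- v) + p * v - y) - psi v)
    (fun v => e * (p * (v * mills (- v))) - dpsi v) u v uv) => t /andP[ut tv].
    have h1 := is_derive_fun_mul (is_derive_cst e t 1) (is_derive_stein_right t).
    by have h2 := dp t; apply: is_derive_eq; rewrite mul0r add0r.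
  rewrite subr_ge0 (mulrCA p) -stein_geE ?(le_trans yu)// dple//.
  by rewrite (le_trans au)// (le_trans tv).
have [by_|/ltW yb] := leP b y; first exact: hl.
have [ya|/ltW ay] := leP y a; first exact: hr.
by have := hl _ _ (lexx a) ay yb (lexx y); have := hr _ _ ay yb (lexx b) (lexx y); lra.
Qed.

Lemma stein_smooth_lin (e c : R) a b : a <= b ->
  (forall t, a <= t <= b -> c <= e * (t * stein t)) ->
  (b - a) * c <= e * (stein_smooth b - stein_smooth a).
Proof.
move=> ab h.
have := @stein_smooth_le e (fun v => v * c) (fun=> c) _ _ ab.
rewrite -mulrBl; apply => // t.
by apply: is_derive_eq; rewrite /GRing.scale/= mulr0 mulr1 add0r.
Qed.

(** A nondecreasing derivative [w * stein w] makes [stein_smooth] convex; the left side is the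
    increment of its tangent at [a]. *)
Lemma stein_smooth_convex a b : a <= b ->
  (b - a) * (a * stein a) <= stein_smooth b - stein_smooth a.
Proof.
move=> ab; rewrite -[leRHS]mul1r; apply: stein_smooth_lin => // t /andP[aT _].
by rewrite mul1r id_stein_le.
Qed.

(** As [w * stein w] lies between [- q] and [p], the slope of [stein] lies in [0, 1] to the left of
    [y] and in [-1, 0] to the right. The increments of [Num.min w y] record how much of the interval
    lies on the left. *)
Lemma stein_lip a b : a <= b -> `|stein b - stein a| <= b - a.
Proof.
move=> ab.
have h1 : (b - a) * - q <= 1 * (stein_smooth b - stein_smooth a).
  by apply: stein_smooth_lin => // t _; rewrite mul1r id_stein_ge.
have h2 : (b - a) * - p <= - 1 * (stein_smooth b - stein_smooth a).
  by apply: stein_smooth_lin => // t _; rewrite mulN1r lerN2 id_stein_ub.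
have [m1 m2] : 0 <= Num.min b y - Num.min a y /\ Num.min b y - Num.min a y <= b - a.
  by split; case: (leP b y) => ?; case: (leP a y) => ?; lra.
move: h1 h2; rewrite /stein_smooth /q -/p => h1 h2.
by rewrite ler_norml; apply/andP; split; nra.
Qed.

Lemma id_stein_lip a b : a <= b ->
  b * stein b - a * stein a <= (`|b| + 3 / 2) * (b - a).
Proof.
move=> ab; have h := stein_lip ab.
have h2 : b * (stein b - stein a) <= `|b| * (b - a).
  by rewrite (le_trans (ler_norm _))// normrM ler_wpM2l.
have h3 : (b - a) * stein a <= (b - a) * (3 / 2).
  by rewrite ler_wpM2l ?subr_ge0// stein_le.
lra.
Qed.

(** Integrates [id_stein_lip] from [t] to the right end [b]; the quadratic test function is the
    antiderivative of that lower bound. In the application [b] is the value of W, so that only the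
    first moment of W enters. *)
Lemma stein_smooth_quad a b : a <= b ->
  (b - a) * (b * stein b) - (`|b| + 3 / 2) * (b - a) ^+ 2 / 2
  <= stein_smooth b - stein_smooth a.
Proof.
move=> ab; pose c : R := `|b| + 3 / 2; pose G := b * stein b.
have := @stein_smooth_le 1 (fun v => v * G + c * (b - v) ^+ 2 / 2)
  (fun v => G - c * (b - v)) _ _ ab.
rewrite mul1r => /(_ _ _)/wrap[]//.
- by move=> t; apply: is_derive_eq; rewrite /GRing.scale/=; field.
- move=> t /andP[_ tb]; rewrite mul1r /G /c.
  by have := id_stein_lip tb; lra.
- by rewrite subrr expr0n/= mulr0 mul0r; rewrite /G /c; lra.
Qed.

Lemma measurable_stein : measurable_fun setT stein.
Proof.
have mN : measurable_fun setT (@ncdf R).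
  by apply: nondecreasing_measurable => // a b ab; exact: ncdf_le.
have mM : measurable_fun setT (@mills R).
  by apply: nondecreasing_measurable => // a b ab; exact: mills_le.
apply: measurable_fun_ifT => //.
- by apply: measurable_fun_ler.
- exact: measurable_funM.
- apply: measurable_funM => //; exact: measurableT_comp.
Qed.

End stein_solution.

(** * Pointwise bounds on the Stein remainder *)

Section stein_remainder.
Context {R : realType} (x0 l : R).
Implicit Types (w x : R).
Local Notation y := (x0 + l).
Local Notation ind w := (\1_(`]-oo, x0]%classic) w : R).

Lemma min_mono (a b c : R) : a <= b -> Num.min a c <= Num.min b c.
Proof. by move=> ab; rewrite le_min !ge_min ab lexx orbT. Qed.

Definition stein_remainder w x : R :=
  x ^+ 2 * (ind w + w * stein y w - ncdf y) - x * (stein y (w + x) - stein y w).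

(** The terms in [ncdf y] cancel. What is left is a smooth part, governed by convexity, and a part
    built from the two cut-offs at [x0] and [y] alone. *)
Lemma stein_remainderE w x : stein_remainder w x =
  (x ^+ 2 * (w * stein y w) - x * (stein_smooth y (w + x) - stein_smooth y w)) +
  (x ^+ 2 * ind w - x * (Num.min (w + x) y - Num.min w y)).
Proof. by rewrite /stein_remainder /stein_smooth; ring. Qed.

Lemma ind_le w : w <= x0 -> ind w = 1.
Proof. by move=> h; rewrite indicE mem_set//= in_itv/=. Qed.

Lemma ind_gt w : x0 < w -> ind w = 0.
Proof. by move=> h; rewrite indicE memNset//= in_itv/= leNgt h. Qed.

(** Convexity makes the smooth part nonpositive. For [w <= x0] the cut-off part vanishes unless the
    step crosses [y]; then it is [x * (x - (y - w))], and [y - w] is at least [l]. *)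
Lemma stein_remainder_pos w x : 0 <= l -> 0 <= x ->
  stein_remainder w x <= x * (x - l) * \1_(`]x0 - (x - l), x0]%classic) w \/
  stein_remainder w x <= 0.
Proof.
move=> l0 xge0; rewrite stein_remainderE.
have wx : w <= w + x by rewrite lerDl.
have := stein_smooth_convex y wx; rewrite addrAC subrr add0r => h.
have {}h : x ^+ 2 * (w * stein y w) - x * (stein_smooth y (w + x) - stein_smooth y w) <= 0.
  by rewrite subr_le0 expr2 -mulrA ler_wpM2l.
have [wx0|wx0] := leP w x0; last first.
  right; rewrite ind_gt// mulr0 sub0r.
  suff : 0 <= x * (Num.min (w + x) y - Num.min w y) by lra.
  by rewrite mulr_ge0// subr_ge0 min_mono.
rewrite ind_le// mulr1 (min_l (_ : w <= y)); last by lra.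
have [h1|h1] := leP (w + x) y.
  by right; move: h; lra.
left.
rewrite indicE mem_set/= ?mulr1; last by rewrite in_itv/= wx0 andbT; lra.
have h2 : x * (x - (y - w)) <= x * (x - l) by rewrite ler_wpM2l//; lra.
by lra.
Qed.

(** A step to the left from [w <= x0] crosses no cut-off, and from [w > x0] the indicator is zero,
    so the cut-off part is nonpositive. For the smooth part, [stein_smooth_quad] gives the cubic
    bound, while the tangent at [w - t] and the oscillation of [w * stein w] give the quadratic
    one. *)
Lemma stein_remainder_neg w t : 0 <= l -> 0 <= t ->
  stein_remainder w (- t) <= (`|w| + 3 / 2) * t ^+ 3 / 2 /\
  stein_remainder w (- t) <= t ^+ 2.
Proof.
move=> l0 t0; rewrite stein_remainderE sqrrN.
have wt : w - t <= w by lra.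
have r1 : t ^+ 2 * ind w + t * (Num.min (w - t) y - Num.min w y) <= 0.
  have [wx0|wx0] := leP w x0; last first.
    by rewrite ind_gt// mulr0 add0r mulr_ge0_le0// subr_le0 min_mono.
  by rewrite ind_le// !min_l; lra.
have h1 := stein_smooth_convex y wt; have h2 := stein_smooth_quad y wt.
have h3 := id_stein_ge y (w - t); have h4 := id_stein_ub y w.
move: h1 h2 h3 h4; set g := stein_smooth y w.
set g' := stein_smooth y (w - t); set G := w * _.
set G' := (w - t) * _; rewrite opprB addrCA subrr addr0 => h1 h2 h3 h4.
have k1 : t * (t * G') <= t * (g - g') by rewrite ler_wpM2l.
have k2 : t * (t * G - (`|w| + 3 / 2) * t ^+ 2 / 2) <= t * (g - g') by rewrite ler_wpM2l.
have k3 : 0 <= t ^+ 2 * (1 - (G - G')) by rewrite mulr_ge0 ?sqr_ge0//; lra.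
split; lra.
Qed.

Lemma stein_remainder_le w x : 0 <= l -> stein_remainder w x <= x ^+ 2.
Proof.
move=> l0; have [x0_|x0_] := leP x 0; first
  by have [] := @stein_remainder_neg w (- x) l0; rewrite ?oppr_ge0// opprK sqrrN.
have x2 := sqr_ge0 x.
have [h|h] := @stein_remainder_pos w x l0 (ltW x0_); last exact: le_trans h x2.
apply: (le_trans h); rewrite indicE expr2.
by case: (_ \in _); rewrite ?mulr0 ?mulr1 -?expr2// mulrBr lerBlDr lerDl mulr_ge0// ltW.
Qed.

End stein_remainder.

(** * Integrals over product probabilities *)

Section product_integrals.
Context d1 d2 (T1 : measurableType d1) (T2 : measurableType d2) (R : realType).
Context (P1 : probability T1 R) (P2 : probability T2 R).
Implicit Types (a : T1 -> R) (b : T2 -> R).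

Lemma integrable_dominated d (T : measurableType d) (P : probability T R)
    (f g : T -> R) (C : R) : measurable_fun setT f ->
  P.-integrable setT (EFin \o g) ->
  (forall x, `|f x| <= C * `|g x|) -> P.-integrable setT (EFin \o f).
Proof.
move=> mf ig fg.
apply: (@le_integrable _ _ _ P setT measurableT _ (EFin \o (fun x => C * g x))).
- exact/measurable_EFinP.
- move=> x _; rewrite /= lee_fin (le_trans (fg x))// normrM ler_wpM2r//.
  exact: ler_norm.
- rewrite (_ : _ \o _ = (fun x => C%:E * (EFin \o g) x)%E).
    exact: integrableZl.
  by apply/funext => x /=; rewrite EFinM.
Qed.

Lemma bounded_integrable d (T : measurableType d) (P : probability T R)
    (f : T -> R) (C : R) : measurable_fun setT f ->
  (forall x, `|f x| <= C) -> P.-integrable setT (EFin \o f).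
Proof.
move=> mf fC; apply: (@integrable_dominated _ _ P f (cst 1) C) => //.
  exact: finite_measure_integrable_cst.
by move=> x; rewrite normr1 mulr1.
Qed.

Lemma Rintegral_prob_cst d (T : measurableType d) (P : probability T R) (r : R) :
  \int[P]_x r = r.
Proof.
rewrite Rintegral_cst// -[RHS]mulr1; congr (_ * _).
by rewrite [X in fine X](@probability_setT _ _ _ P).
Qed.

Lemma Rintegral_indic d (T : measurableType d) (P : probability T R) (A : set T) :
  measurable A -> \int[P]_x (\1_A x) = fine (P A).
Proof. by move=> mA; rewrite /Rintegral integral_indic// setIT. Qed.

Lemma integrable_indic_prob d (T : measurableType d) (P : probability T R) (A : set T) :
  measurable A -> P.-integrable setT (EFin \o \1_A).
Proof.
move=> mA; apply: (@bounded_integrable _ _ P _ 1) => //.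
by move=> x; rewrite indicE; case: (_ \in _); rewrite ?normr1 ?normr0.
Qed.

Lemma integrable_prodM a b :
  P1.-integrable setT (EFin \o a) -> P2.-integrable setT (EFin \o b) ->
  (P1 \x P2)%E.-integrable setT (EFin \o (fun z => a z.1 * b z.2)).
Proof.
move=> ia ib.
have ma := measurable_int _ ia; have mb := measurable_int _ ib.
apply/integrable12ltyP.
  apply/measurable_EFinP; apply: measurable_funM.
    by apply: measurableT_comp => //; exact/measurable_EFinP.
  by apply: measurableT_comp => //; exact/measurable_EFinP.
rewrite (eq_integral (fun x => `|(a x)%:E| * \int[P2]_y `|(b y)%:E|)%E); last first.
  move=> x _; rewrite -ge0_integralZl//=.
    by apply: eq_integral => y _; rewrite -EFinM normrM.
  by apply/measurable_EFinP; apply: measurableT_comp => //; exact/measurable_EFinP.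
rewrite ge0_integralZr//; last 2 first.
- by apply/measurable_EFinP; apply: measurableT_comp => //; exact/measurable_EFinP.
- exact: integral_ge0.
case/integrableP: ia => _ ia; case/integrableP: ib => _ ib.
by rewrite lte_mul_pinfty// ?integral_ge0// ge0_fin_numE ?integral_ge0.
Qed.

Lemma Rintegral_prodM a b :
  P1.-integrable setT (EFin \o a) -> P2.-integrable setT (EFin \o b) ->
  \int[(P1 \x P2)%E]_z (a z.1 * b z.2) = (\int[P1]_x a x) * (\int[P2]_y b y).
Proof.
move=> ia ib; rewrite /Rintegral -integral12_prod_meas1; last exact: integrable_prodM.
have fb := integrable_fin_num measurableT ib.
transitivity (fine (\int[P1]_x ((a x)%:E * \int[P2]_y (b y)%:E)%E)).
  congr fine; apply: eq_integral => x _; rewrite -integralZl//.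
rewrite -(fineK fb) integralZr// fineM//; exact: integrable_fin_num.
Qed.

(** Tonelli for nonnegative [F]. Stating the slice bound in the extended reals makes it also assert
    that every slice integral is finite. *)
Lemma Rintegral_prod_le (F : T1 * T2 -> R) b :
  (P1 \x P2)%E.-integrable setT (EFin \o F) -> P2.-integrable setT (EFin \o b) ->
  (forall z, 0 <= F z) ->
  (forall y, (\int[P1]_x (F (x, y))%:E <= (b y)%:E)%E) ->
  \int[(P1 \x P2)%E]_z F z <= \int[P2]_y b y.
Proof.
move=> iF ib F0 Fb.
have mF := measurable_int _ iF; have mb := measurable_int _ ib.
rewrite /Rintegral fine_le//; [exact: integrable_fin_num|exact: integrable_fin_num|].
have F0' z : (0 <= (EFin \o F) z)%E by rewrite lee_fin.
rewrite -[X in (X <= _)%E]/(\int[(P1 \x P2)%E]_z (EFin \o F) z)%E.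
rewrite fubini_tonelli2//.
apply: ge0_le_integral => //.
- by move=> y _; apply: integral_ge0 => x _; rewrite lee_fin.
- exact: measurable_fun_fubini_tonelli_G.
- by move=> y _; exact: Fb.
Qed.

End product_integrals.

(** * Consequences of the Stein identity *)

Section stein_method.
Context (R : realType) (rho mu : probability R R) (lam : R).
Local Notation joint := (rho \x mu)%E.

(** The minimum of x^2 and |x|^3: a third absolute moment near zero, a second moment far out. *)
Definition lyapunov_weight (x : R) : R := x ^+ 2 * Num.min 1 `|x|.

Context (lam0 : 0 < lam)
  (irho : rho.-integrable setT (EFin \o (fun w : R => w)))
  (imu : mu.-integrable setT (EFin \o (fun x : R => x)))
  (imu2 : mu.-integrable setT (EFin \o (fun x : R => x ^+ 2)))
  (mean0 : \int[mu]_x x = 0) (var1 : lam * \int[mu]_x x ^+ 2 = 1)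
  (steinE : forall (f : R -> R) (C : R), measurable_fun setT f ->
    (forall x, `|f x| <= C) ->
    \int[rho]_w (w * f w) = lam * \int[joint]_z (z.2 * f (z.1 + z.2))).

Lemma measurable_addz (f : R -> R) : measurable_fun setT f ->
  measurable_fun setT (fun z : R * R => f (z.1 + z.2)).
Proof.
move=> mf; apply: (measurableT_comp mf).
by apply: measurable_funD; [exact: measurable_fst|exact: measurable_snd].
Qed.

Lemma measurable_fstz (f : R -> R) : measurable_fun setT f ->
  measurable_fun setT (fun z : R * R => f z.1).
Proof. by move=> mf; apply: (measurableT_comp mf); exact: measurable_fst. Qed.

Lemma measurable_sndz (f : R -> R) : measurable_fun setT f ->
  measurable_fun setT (fun z : R * R => f z.2).
Proof. by move=> mf; apply: (measurableT_comp mf); exact: measurable_snd. Qed.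

Lemma integrable_joint_snd (b : R -> R) : mu.-integrable setT (EFin \o b) ->
  joint.-integrable setT (EFin \o (fun z => b z.2)).
Proof.
move=> ib.
have := integrable_prodM (finite_measure_integrable_cst rho 1 measurableT) ib.
by congr integrable; apply/funext => z /=; rewrite mul1r.
Qed.

Lemma Rintegral_joint_snd (b : R -> R) : mu.-integrable setT (EFin \o b) ->
  \int[joint]_z b z.2 = \int[mu]_x b x.
Proof.
move=> ib.
have := Rintegral_prodM (finite_measure_integrable_cst rho 1 measurableT) ib.
rewrite (Rintegral_prob_cst rho 1) mul1r => <-.
by apply: eq_Rintegral => z _; rewrite mul1r.
Qed.

Lemma integrable_joint_dom (F : R * R -> R) (b : R -> R) (C : R) :
  measurable_fun setT F -> mu.-integrable setT (EFin \o b) ->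
  (forall z, `|F z| <= C * `|b z.2|) -> joint.-integrable setT (EFin \o F).
Proof. by move=> mF ib; apply: integrable_dominated => //; exact: integrable_joint_snd. Qed.

Section bounded_function.
Context (f : R -> R) (C : R) (mf : measurable_fun setT f) (fC : forall x, `|f x| <= C).

Lemma integrable_joint_add : joint.-integrable setT (EFin \o (fun z => z.2 * f (z.1 + z.2))).
Proof.
apply: (@integrable_joint_dom _ (fun x => x) C) => //.
  by apply: measurable_funM; [exact: measurable_snd|exact: measurable_addz].
by move=> z; rewrite normrM mulrC ler_wpM2r.
Qed.

Lemma integrable_joint_fst : joint.-integrable setT (EFin \o (fun z => z.2 * f z.1)).
Proof.
apply: (@integrable_joint_dom _ (fun x => x) C) => //.
  by apply: measurable_funM; [exact: measurable_snd|exact: measurable_fstz].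
by move=> z; rewrite normrM mulrC ler_wpM2r.
Qed.

Lemma integrable_joint_diff :
  joint.-integrable setT (EFin \o (fun z => z.2 * (f (z.1 + z.2) - f z.1))).
Proof.
have := integrableB measurableT integrable_joint_add integrable_joint_fst.
by congr integrable; apply/funext => z /=; rewrite mulrBr EFinB.
Qed.

Lemma Rintegral_joint_fst : \int[joint]_z (z.2 * f z.1) = 0.
Proof.
have := Rintegral_prodM (bounded_integrable rho mf fC) imu.
rewrite mean0 mulr0 => <-.
by apply: eq_Rintegral => z _; rewrite mulrC.
Qed.

(** Since [mu] has mean zero, [z.2 * f z.1] integrates to zero and may be subtracted. This brings in
    increments of [f], of order [z.2] when [f] is Lipschitz. *)
Lemma steinE_diff :
  \int[rho]_w (w * f w) = lam * \int[joint]_z (z.2 * (f (z.1 + z.2) - f z.1)).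
Proof.
rewrite (steinE mf fC).
rewrite (_ : \int[joint]_z (z.2 * (f (z.1 + z.2) - f z.1)) =
   \int[joint]_z (z.2 * f (z.1 + z.2) - z.2 * f z.1)); last first.
  by apply: eq_Rintegral => z _; rewrite mulrBr.
rewrite RintegralB//.
- by rewrite Rintegral_joint_fst subr0.
- exact: integrable_joint_add.
- exact: integrable_joint_fst.
Qed.

Lemma integrable_id_mul : rho.-integrable setT (EFin \o (fun w => w * f w)).
Proof.
apply: (@integrable_dominated _ _ _ rho _ id C) => //.
  exact: measurable_funM.
by move=> w; rewrite normrM mulrC ler_wpM2r.
Qed.

End bounded_function.

(** The bounded stand-in for the identity, since (S) admits bounded functions only. Being
    nondecreasing and 1-Lipschitz, it turns (S) into second-moment bounds. *)
Definition clamp (D w : R) := Num.max (- D) (Num.min D w).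

Lemma measurable_clamp D : measurable_fun setT (clamp D).
Proof. by apply: measurable_maxr => //; exact: measurable_minr. Qed.

Lemma clamp_norm D w : 0 <= D -> `|clamp D w| <= D.
Proof.
by move=> D0; rewrite /clamp ler_norml; case: (leP D w) => ?;
  case: (leP (- D) D) => ?; case: (leP (- D) w) => ?;
  apply/andP; split; lra.
Qed.

Lemma clamp_lip D w x : 0 <= D -> 0 <= x ->
  0 <= clamp D (w + x) - clamp D w <= x.
Proof.
move=> D0 x0; rewrite /clamp.
by case: (leP D w) => ?; case: (leP D (w + x)) => ?;
  case: (leP (- D) D) => ?; case: (leP (- D) w) => ?; case: (leP (- D) (w + x)) => ?;
  apply/andP; split; lra.
Qed.

Lemma clamp_diff D w x : 0 <= D ->
  0 <= x * (clamp D (w + x) - clamp D w) <= x ^+ 2.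
Proof.
move=> D0; rewrite expr2; have [x0|/ltW x0] := leP 0 x.
  have /andP[h1 h2] := clamp_lip w D0 x0.
  by rewrite mulr_ge0//= ler_wpM2l.
have := @clamp_lip D (w + x) (- x) D0; rewrite addrK oppr_ge0 => /(_ x0)/andP[h1 h2].
rewrite mulr_le0 ?ler_wnM2l//; lra.
Qed.

(* [`|w| <= (1 + w * clamp 2 w) / 2]. *)
Lemma abs_moment_le1 : \int[rho]_w `|w| <= 1.
Proof.
have D0 : 0 <= 2 :> R by [].
have mc := measurable_clamp 2; have cC := fun x => clamp_norm x D0.
have ic := integrable_id_mul mc cC.
have i1 : rho.-integrable setT (EFin \o (fun w => (1 + w * clamp 2 w) / 2)).
  apply: (@integrable_dominated _ _ _ rho _ (fun w => 1 + w * clamp 2 w) 1).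
  - apply: measurable_funM => //; apply: measurable_funD => //; exact: measurable_funM.
  - have := integrableD measurableT (finite_measure_integrable_cst rho 1 measurableT) ic.
    by congr integrable; apply/funext => w /=; rewrite EFinD.
  - by move=> w; rewrite normrM mul1r ler_piMr// ger0_norm; lra.
apply: (@le_trans _ _ (\int[rho]_w ((1 + w * clamp 2 w) / 2))).
  apply: le_Rintegral => //.
    apply: (@integrable_dominated _ _ _ rho _ id 1) => //.
    by move=> w; rewrite normr_id mul1r.
  move=> w _; rewrite /clamp.
  have h1 := sqr_ge0 (w - 1); have h2 := sqr_ge0 (w + 1).
  case: (leP (2 : R) w) => ?; case: (leP (- 2 : R) 2) => ?; case: (leP (- 2 : R) w) => ?;
    by case: (ger0P w) => ?; lra.
rewrite RintegralZr//; last first.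
  have := integrableD measurableT (finite_measure_integrable_cst rho 1 measurableT) ic.
  by congr integrable; apply/funext => w /=; rewrite EFinD.
rewrite RintegralD//; last exact: finite_measure_integrable_cst.
rewrite Rintegral_prob_cst.
rewrite (steinE_diff mc cC).
suff : lam * \int[joint]_z (z.2 * (clamp 2 (z.1 + z.2) - clamp 2 z.1)) <= 1 by lra.
rewrite -[leRHS]var1 ler_pM2l// -Rintegral_joint_snd//.
apply: le_Rintegral => //.
- exact: (integrable_joint_diff mc cC).
- exact: (integrable_joint_snd imu2).
- by move=> z _; have /andP[] := clamp_diff z.1 z.2 D0.
Qed.


Lemma measurable_weight : measurable_fun setT lyapunov_weight.
Proof.
apply: measurable_funM => //; apply: measurable_minr => //.
Qed.

Lemma weight_ge0 x : 0 <= lyapunov_weight x.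
Proof. by rewrite mulr_ge0 ?sqr_ge0// le_min ler01 normr_ge0. Qed.

Lemma weight_le x : lyapunov_weight x <= x ^+ 2.
Proof. by rewrite ler_piMr ?sqr_ge0// ge_min lexx. Qed.

Lemma integrable_weight : mu.-integrable setT (EFin \o lyapunov_weight).
Proof.
apply: (@integrable_dominated _ _ _ mu _ (fun x => x ^+ 2) 1) => //.
  exact: measurable_weight.
by move=> x; rewrite mul1r !ger0_norm ?sqr_ge0 ?weight_ge0// weight_le.
Qed.

(** * Concentration inequality and one-sided bound under (S) *)

Section concentration.
Context (l : R) (l0 : 0 < l) (l1 : l <= 3 / 5)
  (weight_l : lam * \int[mu]_x lyapunov_weight x <= l).

(** From [w] in the interval, the centred clamp stays linear for at least [l / 2] in both
    directions, because its height exceeds the half-length by [l / 2]. The product on the right is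
    thus at least [t * Num.min t (l / 2)] with t = |x|. *)
Lemma clamp_slope (a b w x : R) : 0 < l -> l <= 3 / 5 -> a < w <= b ->
  x ^+ 2 - 3 / 5 / l * lyapunov_weight x <=
  x * (clamp ((b - a + l) / 2) (w + x - (a + b) / 2) -
       clamp ((b - a + l) / 2) (w - (a + b) / 2)).
Proof.
move=> l0' l1' /andP[aw wb].
set D := _ / 2; set m := _ / 2; have Dl : D = (b - a) / 2 + l / 2 by rewrite /D; lra.
have m1 : w - m <= (b - a) / 2 by rewrite /m; lra.
have m2 : - ((b - a) / 2) <= w - m by rewrite /m; lra.
move: D m Dl m1 m2 => D m Dl m1 m2.
have c1 : clamp D (w - m) = w - m.
  by rewrite /clamp min_r ?max_r//; lra.
rewrite c1; set k := 3 / 5 / l; have kl : k * l = 3 / 5 by rewrite divfK// gt_eqF.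
(* For [t >= 1] this needs [k >= 1], that is [l <= 3 / 5]; for [l / 2 < t < 1] it is a quadratic
   inequality in [t] with negative discriminant. *)
have key t : 0 <= t -> t ^+ 2 - k * (t ^+ 2 * Num.min 1 t) <= t * Num.min t (l / 2).
  move=> t0; have k0 : 0 <= k by rewrite divr_ge0// ltW.
  have [tl|tl] := leP t (l / 2).
    have : 0 <= k * (t ^+ 2 * Num.min 1 t).
      have m0 : 0 <= Num.min 1 t by rewrite le_min ler01.
      exact/mulr_ge0/mulr_ge0/m0/sqr_ge0.
    lra.
  rewrite expr2 -mulrA mulrCA -mulrBr ler_wpM2l//.
  have [t1|t1] := leP 1 t.
    have : 1 <= k by rewrite ler_pdivlMr ?mul1r.
    nra.
  rewrite -(@ler_pM2r _ l)// mulrBl mulrAC kl.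
  (* Completing the square in 3/5 t^2 - l t + l^2 / 2 leaves the positive remainder l^2 / 12. *)
  have := sqr_ge0 (t - l / 2 * (5 / 3)); nra.
have [x0|x0] := leP 0 x.
  have -> : clamp D (w + x - m) = w - m + Num.min x (D - (w - m)).
    rewrite /clamp addrAC; case: (leP x (D - (w - m))) => ?; first by rewrite min_r ?max_r//; lra.
    by rewrite min_l ?max_r//; lra.
  rewrite addrAC subrr add0r /lyapunov_weight ger0_norm//.
  apply: le_trans (key x x0) _; rewrite ler_wpM2l//.
  by rewrite le_min ge_min lexx ge_min; apply/orP; right; lra.
have -> : clamp D (w + x - m) = w - m - Num.min (- x) (w - m + D).
  rewrite /clamp addrAC; case: (leP (- x) (w - m + D)) => ?; first by rewrite min_r ?max_r//; lra.
  by rewrite min_r ?max_l//; lra.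
rewrite addrAC subrr add0r mulrN -mulNr /lyapunov_weight ltr0_norm//.
have x0' : 0 <= - x by lra.
rewrite -sqrrN; apply: le_trans (key (- x) x0') _; rewrite ler_wpM2l//.
by rewrite le_min ge_min lexx ge_min; apply/orP; right; lra.
Qed.

Lemma integrable_norm : rho.-integrable setT (EFin \o (fun w : R => `|w|)).
Proof.
apply: (@integrable_dominated _ _ _ rho _ id 1) => //.
by move=> w; rewrite normr_id mul1r.
Qed.

(** (S) is tested with the clamp of height [D] centred at the midpoint. One side is at most [D]
    times E |W|, hence at most [D]; the other is at least the mass of the interval times 1 - k l =
    2/5. Finally [D / (2 / 5)] is 5/4 (b - a + l). *)
Lemma concentration (a b : R) : a <= b ->
  fine (rho `]a, b]%classic) <= 5 / 4 * (b - a + l).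
Proof.
move=> ab; have l0' := l0; have l1' := l1; have lam0' := lam0.
pose D := (b - a + l) / 2; pose f w := clamp D (w - (a + b) / 2).
pose k := 3 / 5 / l; pose c x := x ^+ 2 - k * lyapunov_weight x.
pose ind : R -> R := \1_(`]a, b]%classic).
have D0 : 0 <= D by rewrite /D; lra.
have mf : measurable_fun setT f.
  by apply: (measurableT_comp (measurable_clamp D)); exact: measurable_funB.
have fD x : `|f x| <= D by exact: clamp_norm.
have ikw : mu.-integrable setT (EFin \o (fun x => k * lyapunov_weight x)).
  apply: (@integrable_dominated _ _ _ mu _ _ `|k| _ integrable_weight).
    by apply: measurable_funM => //; exact: measurable_weight.
  by move=> x; rewrite normrM.
have ic : mu.-integrable setT (EFin \o c).
  have := integrableB measurableT imu2 ikw.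
  by congr integrable; apply/funext => x /=; rewrite EFinB.
have iind : rho.-integrable setT (EFin \o ind) by exact: integrable_indic_prob.
have h1 : lam * \int[joint]_z (ind z.1 * c z.2) <= \int[rho]_w (w * f w).
  rewrite (steinE_diff mf fD) ler_pM2l//; apply: le_Rintegral => //.
  - exact: integrable_prodM.
  - exact: (integrable_joint_diff mf fD).
  - move=> z _; rewrite /ind indicE; case: (boolP (_ \in _)) => [/set_mem|_].
      by rewrite /= in_itv/= mul1r => h; exact: clamp_slope.
    (* Off the interval only monotonicity of the clamp is used. *)
    rewrite mul0r /f.
    have := clamp_diff (z.1 - (a + b) / 2) z.2 D0.
    by rewrite (addrAC z.1) => /andP[].
have h2 : \int[rho]_w (w * f w) <= D.
  apply: (@le_trans _ _ (\int[rho]_w (D * `|w|))).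
    apply: le_Rintegral => //.
    - exact: (integrable_id_mul mf fD).
    - apply: (@integrable_dominated _ _ _ rho _ id D) => //.
        exact: measurable_funM.
      by move=> x; rewrite normrM normr_id ger0_norm.
    - move=> w _; rewrite (le_trans (ler_norm _))// normrM mulrC ler_wpM2r//.
  rewrite RintegralZl//; last exact: integrable_norm.
  by rewrite ler_piMr// abs_moment_le1.
have h3 : lam * \int[mu]_x c x = 1 - k * (lam * \int[mu]_x lyapunov_weight x).
  rewrite /c RintegralB// RintegralZl//; last exact: integrable_weight.
  by rewrite mulrBr var1 mulrCA.
have h4 : 2 / 5 <= lam * \int[mu]_x c x.
  rewrite h3; have : k * (lam * \int[mu]_x lyapunov_weight x) <= k * l.
    by rewrite ler_wpM2l ?divr_ge0// ltW.
  by rewrite /k divfK ?gt_eqF//; lra.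
move: h1; rewrite (Rintegral_prodM iind ic) Rintegral_indic// mulrCA.
set F := fine _ => h1.
have F0 : 0 <= F by rewrite fine_ge0.
have : F * (2 / 5) <= F * (lam * \int[mu]_x c x) by rewrite ler_wpM2l.
move: h2; rewrite /D; lra.
Qed.


Lemma measurable_stein_remainder (x0 k x : R) :
  measurable_fun setT (fun w => stein_remainder x0 k w x).
Proof.
have mf := measurable_stein (x0 + k).
apply: measurable_funB; apply: measurable_funM => //.
  apply: measurable_funB => //; apply: measurable_funD.
    exact: measurable_indic.
  exact: measurable_funM.
apply: measurable_funB => //; apply: (measurableT_comp mf).
exact: measurable_funD.
Qed.

(** Concentration acts only after averaging over [w], so the step [x] stays fixed here. The four
    cases are a long step, a negative step, a positive step up to [l], and a positive step beyond
    [l]. *)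
Lemma integral_stein_remainder (x0 x : R) :
  (\int[rho]_w (Num.max 0 (stein_remainder x0 l w x))%:E <=
   (5 / 4 * lyapunov_weight x)%:E)%E.
Proof.
have l0' := l0; have l0w := ltW l0.
have aux (h : R -> R) : rho.-integrable setT (EFin \o h) ->
    (forall w, Num.max 0 (stein_remainder x0 l w x) <= h w) ->
    \int[rho]_w h w <= 5 / 4 * lyapunov_weight x ->
    (\int[rho]_w (Num.max 0 (stein_remainder x0 l w x))%:E <=
     (5 / 4 * lyapunov_weight x)%:E)%E.
  move=> ih qh hx.
  apply: (@le_trans _ _ (\int[rho]_w (h w)%:E)%E).
    apply: ge0_le_integral => //.
    - by move=> w _; rewrite lee_fin le_max lexx.
    - apply/measurable_EFinP; apply: measurable_maxr => //.
      exact: measurable_stein_remainder.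
    - exact: measurable_int ih.
    - by move=> w _; rewrite lee_fin.
  by rewrite -(fineK (integrable_fin_num measurableT ih)) lee_fin.
have x20 := sqr_ge0 x.
have [x1|x1] := leP 1 `|x|.
  apply: (aux (cst (x ^+ 2))).
  - exact: finite_measure_integrable_cst.
  - by move=> w; rewrite ge_max x20 stein_remainder_le.
  - by rewrite Rintegral_prob_cst /lyapunov_weight min_l// mulr1; lra.
have wE : lyapunov_weight x = x ^+ 2 * `|x| by rewrite /lyapunov_weight min_r// ltW.
have [xge0|xlt0] := leP 0 x; last first.
  have t0 : 0 <= - x by lra.
  have in1 : rho.-integrable setT (EFin \o (fun w : R => `|w| + 3 / 2)).
    have := integrableD measurableT integrable_norm
      (finite_measure_integrable_cst rho (3 / 2) measurableT).
    by congr integrable; apply/funext => w /=; rewrite EFinD.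
  (* With E |W| <= 1 the factor is (1 + 3/2) / 2 = 5/4. *)
  apply: (aux (fun w => (`|w| + 3 / 2) * ((- x) ^+ 3 / 2))).
  - have := integrableZr measurableT ((- x) ^+ 3 / 2) in1.
    by congr integrable; apply/funext => w /=; rewrite EFinM.
  - move=> w; rewrite mulrA ge_max; apply/andP; split.
      by rewrite !mulr_ge0 ?exprn_ge0// addr_ge0.
    by have [] := @stein_remainder_neg _ x0 l w _ l0w t0; rewrite opprK.
  - rewrite RintegralZr//.
    rewrite RintegralD// ?Rintegral_prob_cst; [|exact: integrable_norm|exact: finite_measure_integrable_cst].
    rewrite wE ltr0_norm// -[x ^+ 2]sqrrN -exprSr.
    have := abs_moment_le1; have : 0 <= (- x) ^+ 3 by rewrite exprn_ge0.
    nra.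
(* A positive step of length at most [l] cannot get from [x0] past [y], so it contributes
   nothing. *)
have [xl|lx] := leP x l.
  apply: (aux (cst 0)).
  - exact: finite_measure_integrable_cst.
  - move=> w; rewrite ge_max lexx /=.
    have [h|//] := @stein_remainder_pos _ x0 l w x l0w xge0.
    by apply: (le_trans h); rewrite mulr_le0_ge0// mulr_ge0_le0// subr_le0.
  - by rewrite Rintegral_prob_cst mulr_ge0// weight_ge0.
pose A := `]x0 - (x - l), x0]%classic.
apply: (aux (fun w => x * (x - l) * \1_A w)).
- have mA : measurable A by exact: measurable_itv.
  have := integrableZl measurableT (x * (x - l)) (integrable_indic_prob rho mA).
  by congr integrable; apply/funext => w /=; rewrite EFinM.
- move=> w; rewrite ge_max; apply/andP; split.
    by rewrite !mulr_ge0 ?subr_ge0 ?(ltW lx)//.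
  have [h|h] := @stein_remainder_pos _ x0 l w x l0w xge0; first exact: h.
  by apply: (le_trans h); rewrite !mulr_ge0 ?subr_ge0 ?(ltW lx)//.
- rewrite RintegralZl//; last by apply: integrable_indic_prob; exact: measurable_itv.
  rewrite Rintegral_indic//.
  have ab : x0 - (x - l) <= x0 by lra.
  have := concentration ab.
  (* The length [x - l] plus the additive [l] is exactly [x]: the shift of [y] is chosen for this
     cancellation. *)
  rewrite (_ : _ + l = x); last by ring.
  rewrite wE ger0_norm// => h.
  have : x * (x - l) * fine (rho A) <= x * (x - l) * (5 / 4 * x).
    by rewrite ler_wpM2l// mulr_ge0// subr_ge0 ltW.
  have : 0 <= x * x * l by rewrite !mulr_ge0.
  lra.
exact: measurable_itv.
Qed.

Lemma stein_cdf_le (x0 : R) :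
  fine (rho `]-oo, x0]%classic) <= ncdf x0 + 7 / 4 * l.
Proof.
have l0' := l0; have lam0' := lam0; have wl := weight_l.
pose y := x0 + l; pose p : R := ncdf y.
pose ind : R -> R := \1_(`]-oo, x0]%classic).
have mf := measurable_stein y.
have fC w : `|stein y w| <= 3 / 2.
  by rewrite ger0_norm ?stein_ge0// stein_le.
pose A w := ind w + w * stein y w - p.
have iind : rho.-integrable setT (EFin \o ind) by exact: integrable_indic_prob.
have isf := integrable_id_mul mf fC.
have iA : rho.-integrable setT (EFin \o A).
  have := integrableB measurableT (integrableD measurableT iind isf)
    (finite_measure_integrable_cst rho p measurableT).
  by congr integrable; apply/funext => w /=; rewrite /A EFinB EFinD.
have iq1 := integrable_prodM iA imu2.
have iq2 := integrable_joint_diff mf fC.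
have iq : joint.-integrable setT (EFin \o (fun z => stein_remainder x0 l z.1 z.2)).
  have := integrableB measurableT iq1 iq2.
  congr integrable; apply/funext => z /=; rewrite -EFinB /stein_remainder.
  by congr (_%:E); rewrite /A -/y -/p /ind; ring.
(* The factor [x ^+ 2] integrates to [1 / lam] independently of [A], and [steinE_diff] cancels the
   mean of [w * stein y w] against the increments of [stein y]. *)
have E : lam * \int[joint]_z stein_remainder x0 l z.1 z.2 = fine (rho `]-oo, x0]%classic) - p.
  transitivity (lam * \int[joint]_z (A z.1 * z.2 ^+ 2 - z.2 * (stein y (z.1 + z.2) - stein y z.1))).
    congr (_ * _); apply: eq_Rintegral => z _.
    by rewrite /stein_remainder /A -/y -/p /ind; ring.
  rewrite RintegralB// mulrBr -(steinE_diff mf fC) (Rintegral_prodM iA imu2) mulrCA var1 mulr1.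
  have iis : rho.-integrable setT (EFin \o (fun w => ind w + w * stein y w)).
    have := integrableD measurableT iind isf.
    by congr integrable; apply/funext => w /=; rewrite EFinD.
  have ip : rho.-integrable setT (EFin \o cst p) by exact: finite_measure_integrable_cst.
  rewrite (RintegralB measurableT iis ip).
  rewrite RintegralD// Rintegral_prob_cst Rintegral_indic//.
  ring.
(* The positive part makes Tonelli available, so that [w] can be integrated first for each fixed
   [x]. *)
pose q z := Num.max 0 (stein_remainder x0 l z.1 z.2).
have iq' : joint.-integrable setT (EFin \o q).
  apply: (@integrable_dominated _ _ _ (rho \x mu)%E _ _ 1 _ iq).
    apply: measurable_maxr => //; apply/measurable_EFinP.
    exact: measurable_int iq.
  move=> z; rewrite mul1r /q; case: (leP 0) => h; first by [].
  by rewrite normr0.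
have h1 : \int[joint]_z stein_remainder x0 l z.1 z.2 <= \int[joint]_z q z.
  by apply: le_Rintegral => // z _; rewrite /q le_max lexx orbT.
have h2 : \int[joint]_z q z <= \int[mu]_x (5 / 4 * lyapunov_weight x).
  apply: Rintegral_prod_le => //.
  - apply: (@integrable_dominated _ _ _ mu _ _ (5 / 4) _ integrable_weight).
      by apply: measurable_funM => //; exact: measurable_weight.
    by move=> x; rewrite normrM ger0_norm.
  - by move=> z; rewrite /q le_max lexx.
  - by move=> x; exact: integral_stein_remainder.
rewrite RintegralZl// in h2; last exact: integrable_weight.
have h3 := @ncdf_lip R x0 y.
have h4 : fine (rho `]-oo, x0]%classic) - p <= 5 / 4 * l.
  rewrite -E (le_trans (_ : _ <= lam * (5 / 4 * \int[mu]_x lyapunov_weight x)))//.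
    by rewrite ler_pM2l// (le_trans h1).
  by rewrite mulrCA ler_pM2l.
move: h3; rewrite lerDl => /(_ (ltW l0)); rewrite /y -/p; move: h4; rewrite /p /y.
lra.
Qed.

End concentration.

End stein_method.

Definition law d d' (T : measurableType d) (T' : measurableType d') (R : realType)
    (P : probability T R) (f : T -> T') (mf : measurable_fun setT f) : probability T' R :=
  distribution P (mfun_of mf).

(** * Laws of random sums *)

Section law.
Context d d' (T : measurableType d) (T' : measurableType d') (R : realType)
  (P : probability T R) (f : T -> T') (mf : measurable_fun setT f).

Lemma integrable_law (h : T' -> R) : measurable_fun setT h ->
  P.-integrable setT (EFin \o (h \o f)) <-> (law P mf).-integrable setT (EFin \o h).
Proof.
move=> mh.
have mEh : measurable_fun setT (EFin \o h) by exact/measurable_EFinP.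
split=> ih; apply/integrableP; split => //.
- rewrite ge0_integral_distribution//; last exact: measurableT_comp.
  by case/integrableP: ih.
- exact: (measurableT_comp mEh mf).
- case/integrableP : ih => _; rewrite ge0_integral_distribution//.
  exact: measurableT_comp.
Qed.

Lemma Rintegral_law (h : T' -> R) : measurable_fun setT h ->
  P.-integrable setT (EFin \o (h \o f)) ->
  \int[law P mf]_y h y = \int[P]_x h (f x).
Proof.
move=> mh ih; congr fine.
apply: (@integral_distribution _ _ _ _ _ P (mfun_of mf) (EFin \o h)) => //.
exact/measurable_EFinP.
Qed.

End law.

(** * Joint laws and independence of partial sums *)

Section pair_law.
Context d (T : measurableType d) (R : realType) (P : probability T R)
  (U V : T -> R) (mU : measurable_fun setT U) (mV : measurable_fun setT V).

Lemma measurable_pair : measurable_fun setT (fun w => (U w, V w)).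
Proof. exact: measurable_fun_pair. Qed.

(** In [Z], both sides are measures that agree on rectangles, a generating class closed under
    intersection. The event [E] and the factor [c] transport conditions on further variables. *)
Lemma pair_law_event (E : set T) (c : {nonneg R}) : measurable E ->
  (forall A B, measurable A -> measurable B ->
    P (E `&` (U @^-1` A `&` V @^-1` B)) = c%:num%:E * (P (U @^-1` A) * P (V @^-1` B)))%E ->
  forall Z, measurable Z ->
  P (E `&` (fun w => (U w, V w)) @^-1` Z) = (c%:num%:E * (law P mU \x law P mV) Z)%E.
Proof.
move=> mE hE Z mZ.
pose m1 := pushforward (mrestr P mE) (mfun_of measurable_pair).
pose m2 := mscale c (law P mU \x law P mV)%E.
transitivity (m1 Z); first by rewrite /m1/= /pushforward /mrestr setIC.
pose C : set (set (R * R)) :=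
  [set Z | exists A B, [/\ measurable A, measurable B & Z = A `*` B]].
rewrite -[RHS]/(m2 Z); apply: (measure_unique C (fun=> setT)) => //.
- rewrite measurable_prod_measurableType; congr (<<s _ >>).
  rewrite predeqE => X; split => [[A mA [B mB <-]]|[A [B [mA mB ->]]]].
    by exists A, B.
  by exists A => //; exists B.
- move=> _ _ [A1 [B1 [mA1 mB1 ->]]] [A2 [B2 [mA2 mB2 ->]]].
  exists (A1 `&` A2), (B1 `&` B2); split; [exact: measurableI|exact: measurableI|].
  by rewrite setXI.
- by move=> _; exists setT, setT; split => //; rewrite setXTT.
- by rewrite bigcup_const.
- move=> _ [A [B [mA mB ->]]].
  have e := product_measure1E (law P mU) (law P mV) mA mB.
  rewrite /m2 /= /mscale [X in (_ * X)%E]e -hE//.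
  by rewrite /m1 /= /pushforward /mrestr setIC.
- move=> _; rewrite /m1/= /pushforward /mrestr preimage_setT setTI.
  by apply: le_lt_trans (probability_le1 P mE) _; exact: ltry.
Qed.

Hypothesis UV : forall A B, measurable A -> measurable B ->
  P (U @^-1` A `&` V @^-1` B) = (P (U @^-1` A) * P (V @^-1` B))%E.

Lemma pair_law_indep Z : measurable Z ->
  P ((fun w => (U w, V w)) @^-1` Z) = (law P mU \x law P mV)%E Z.
Proof.
move=> mZ; rewrite -[X in P X]setTI (@pair_law_event setT 1%:nng) ?mul1e//.
by move=> A B mA mB; rewrite setTI UV// mul1e.
Qed.

Lemma indep_integrable (h : R * R -> R) : measurable_fun setT h ->
  P.-integrable setT (EFin \o (fun w => h (U w, V w))) <->
  (law P mU \x law P mV)%E.-integrable setT (EFin \o h).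
Proof.
move=> mh; rewrite -[X in X <-> _]/(is_true (P.-integrable setT (EFin \o (h \o (fun w => (U w, V w)))))).
rewrite (integrable_law P measurable_pair mh).
have e : (\int[law P measurable_pair]_z `|(h z)%:E| = \int[(law P mU \x law P mV)%E]_z `|(h z)%:E|)%E.
  by apply: eq_measure_integral => A mA _; exact: (pair_law_indep mA).
by split=> /integrableP[mEh hoo]; apply/integrableP; split => //; move: hoo; rewrite /comp e.
Qed.

Lemma indep_Rintegral (h : R * R -> R) : measurable_fun setT h ->
  P.-integrable setT (EFin \o (fun w => h (U w, V w))) ->
  \int[P]_w h (U w, V w) = \int[(law P mU \x law P mV)%E]_z h z.
Proof.
move=> mh ih; have := Rintegral_law measurable_pair mh ih => <-.
by congr fine; apply: eq_measure_integral => A mA _; exact: (pair_law_indep mA).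
Qed.

Lemma indep_Rintegral_mul (a b : R -> R) : measurable_fun setT a -> measurable_fun setT b ->
  P.-integrable setT (EFin \o (a \o U)) -> P.-integrable setT (EFin \o (b \o V)) ->
  P.-integrable setT (EFin \o (fun w => a (U w) * b (V w))) /\
  \int[P]_w (a (U w) * b (V w)) = (\int[P]_w a (U w)) * (\int[P]_w b (V w)).
Proof.
move=> ma mb ia ib.
have ila := (integrable_law P mU ma).1 ia.
have ilb := (integrable_law P mV mb).1 ib.
have mab : measurable_fun setT (fun z : R * R => a z.1 * b z.2).
  by apply: measurable_funM; [exact: measurable_fstz|exact: measurable_sndz].
have iab : P.-integrable setT (EFin \o (fun w => a (U w) * b (V w))).
  by apply/(indep_integrable mab); exact: integrable_prodM.
split => //.
rewrite -(Rintegral_law mU ma ia) -(Rintegral_law mV mb ib).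
rewrite -Rintegral_prodM//.
exact: (indep_Rintegral mab iab).
Qed.

End pair_law.

Section random_sum_law.
Context d (T : measurableType d) (R : realType) (P : probability T R)
  (X : nat -> T -> R) (N : T -> nat).
Context (mX : forall i, measurable_fun setT (X i)) (mN : measurable_fun setT N)
  (indepX : indep_N_Xs P N X).

Definition psum k (w : T) : R := \sum_(i < k) X i w.

Lemma psumS k w : psum k.+1 w = psum k w + X k w.
Proof. by rewrite /psum big_ord_recr. Qed.

Lemma measurable_psum k : measurable_fun setT (psum k).
Proof. by apply: measurable_sum => i. Qed.

Lemma measurable_N_event (A : set nat) : measurable (N @^-1` A).
Proof. by rewrite -[X in measurable X]setTI; exact: mN. Qed.

(** Induction on [k], with the number [m] of untouched later variables left free: the step views the
    next partial sum as a function of [psum k] and [X k], and the induction hypothesis for [m.+1]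
    supplies the rectangles. *)
Lemma psum_indep k m (A : set nat) (C : set R) (B : nat -> set R) :
  measurable C -> (forall i, measurable (B i)) ->
  P (N @^-1` A `&` psum k @^-1` C `&` \bigcap_(i in `I_m) (X (k + i)%N @^-1` B i)) =
  (P (N @^-1` A) * P (psum k @^-1` C) * \prod_(i < m) P (X (k + i)%N @^-1` B i))%E.
Proof.
elim: k m A C B => [|k IH] m A C B mC mB.
  have -> : psum 0 = cst 0 by apply/funext => w; rewrite /psum big_ord0.
  rewrite preimage_cst; case: ifPn => C0.
    by rewrite setIT probability_setT mule1; apply: indepX.
  by rewrite setI0 set0I measure0 mule0 mul0e.
have bigcap1 (B' : set R) (B1 : nat -> set R) :
    \bigcap_(i in `I_m.+1) (X (k + i)%N @^-1` (if i is j.+1 then B1 j else B')) =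
    X k @^-1` B' `&` \bigcap_(i in `I_m) (X (k.+1 + i)%N @^-1` B1 i).
  apply/seteqP; split => w /=.
    move=> h; split; first by have := h 0%N isT; rewrite addn0.
    by move=> i im; have := h i.+1 im; rewrite addnS addSn.
  move=> [h0 h] [|i] im; first by rewrite addn0.
  by rewrite addnS -addSn; exact: h.
pose D := N @^-1` A `&` \bigcap_(i in `I_m) (X (k.+1 + i)%N @^-1` B i).
have mXB i (B' : set R) : measurable B' -> measurable (X i @^-1` B').
  by move=> mB'; rewrite -[X in measurable X]setTI; exact: mX.
have mD : measurable D.
  apply: measurableI; first exact: measurable_N_event.
  by apply: bigcap_measurableType => i _; exact: mXB.
(* The probability that [D] should contribute as a factor, made a nonnegative real to fit
   [pair_law_event]. *)
pose ce := (P (N @^-1` A) * \prod_(i < m) P (X (k.+1 + i)%N @^-1` B i))%E.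
have ce_fin : ce \is a fin_num.
  rewrite fin_numM//; first by rewrite fin_num_measure//; exact: measurable_N_event.
  elim/big_ind : _ => //; first by move=> *; exact: fin_numM.
  by move=> i _; rewrite fin_num_measure//; exact: mXB.
have ce_ge0 : 0 <= fine ce.
  by rewrite fine_ge0// mule_ge0// prode_ge0.
pose c := NngNum ce_ge0.
have cE : c%:num%:E = ce by rewrite /= fineK.
have hE (A' B' : set R) : measurable A' -> measurable B' ->
    (P (D `&` (psum k @^-1` A' `&` X k @^-1` B')) =
    c%:num%:E * (P (psum k @^-1` A') * P (X k @^-1` B')))%E.
  move=> mA' mB'; rewrite cE.
  pose B'' i := if i is j.+1 then B j else B'.
  have mB'' i : measurable (B'' i) by case: i.
  (* [X k] becomes the first of the later variables, with [B'] put in front of [B]. *)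
  have h := IH m.+1 A A' B'' mA' mB''.
  rewrite (_ : D `&` _ = N @^-1` A `&` psum k @^-1` A' `&`
      (X k @^-1` B' `&` \bigcap_(i in `I_m) (X (k.+1 + i)%N @^-1` B i))); last first.
    by rewrite /D setIACA (setIC (X k @^-1` B')).
  rewrite -bigcap1 h big_ord_recl /= addn0.
  under eq_bigr do rewrite /bump /= addnA addn1.
  by rewrite [X in (_ * X)%E]muleC muleACA.
(* The rule without [D] is needed to turn the product measure of [Z] back into the probability that
   [psum k.+1] lies in [C]. *)
have UV (A' B' : set R) : measurable A' -> measurable B' ->
    P (psum k @^-1` A' `&` X k @^-1` B') =
    (P (psum k @^-1` A') * P (X k @^-1` B'))%E.
  move=> mA' mB'; have := IH 1%N setT A' (fun=> B') mA' (fun=> mB').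
  by rewrite preimage_setT setTI probability_setT mul1e big_ord1 II1 bigcap_set1 addn0.
pose Z : set (R * R) := [set z | C (z.1 + z.2)].
have mZ : measurable Z.
  rewrite -[X in measurable X]setTI; apply: (measurable_funD _ _) => //.
have SE : psum k.+1 @^-1` C = (fun w => (psum k w, X k w)) @^-1` Z.
  by apply/funext => w; rewrite /Z /preimage/= psumS.
transitivity (P (D `&` psum k.+1 @^-1` C)).
  by congr (P _); rewrite /D setIAC.
rewrite SE (pair_law_event (measurable_psum k) (mX k) mD hE mZ).
by rewrite -(pair_law_indep _ _ UV mZ) -SE cE /ce muleAC.
Qed.

End random_sum_law.

Section Rintegral_fubini.
Context d1 d2 (T1 : measurableType d1) (T2 : measurableType d2) (R : realType).
Context (P1 : probability T1 R) (P2 : probability T2 R) (g : T1 * T2 -> R).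
Context (ig : (P1 \x P2)%E.-integrable setT (EFin \o g))
  (ig2 : forall x, P2.-integrable setT (EFin \o (fun y => g (x, y)))).

(** Every slice being integrable, [fine] loses nothing at any point, so the equality holds
    everywhere and not only almost everywhere. *)
Lemma Rintegral_fubini_FE :
  EFin \o (fun x => \int[P2]_y g (x, y)) = fubini_F P2 (EFin \o g).
Proof.
by apply/funext => x /=; rewrite /Rintegral fineK//; exact: (integrable_fin_num measurableT (ig2 x)).
Qed.

Lemma measurable_Rintegral_snd : measurable_fun setT (fun x => \int[P2]_y g (x, y)).
Proof.
by apply/measurable_EFinP; rewrite Rintegral_fubini_FE; exact: measurable_fubini_F ig.
Qed.

Lemma integrable_Rintegral_snd :
  P1.-integrable setT (EFin \o (fun x => \int[P2]_y g (x, y))).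
Proof. by rewrite Rintegral_fubini_FE; exact: integrable_fubini_F. Qed.

Lemma Rintegral_prod_snd :
  \int[(P1 \x P2)%E]_z g z = \int[P1]_x \int[P2]_y g (x, y).
Proof.
rewrite /Rintegral -(integral12_prod_meas1 ig); congr fine.
by apply: eq_integral => x _; rewrite -Rintegral_fubini_FE.
Qed.

End Rintegral_fubini.

(** * Stein identity for compound Poisson sums *)

Section compound_sum.
Context d (T : measurableType d) (R : realType) (P : probability T R)
  (X : nat -> T -> R) (N : T -> nat) (lam : R).
Context (mX : forall i, measurable_fun setT (X i)) (mN : measurable_fun setT N)
  (identX : ident_distr P X) (indepX : indep_N_Xs P N X)
  (iX : P.-integrable setT (EFin \o X 0%N)) (lam0 : 0 < lam)
  (poissonN : poisson_rv P lam N).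

Let mu := law P (mX 0%N).
Local Notation S := (psum X).
Let mS := measurable_psum mX.

Lemma integrable_lawX : mu.-integrable setT (EFin \o (fun x : R => x)).
Proof. exact/integrable_law. Qed.

Lemma integrable_X k : P.-integrable setT (EFin \o X k).
Proof.
apply/(integrable_law P (mX k) (@measurable_id _ R setT)).
have /integrableP[m1 i1] := integrable_lawX.
apply/integrableP; split; first exact: m1.
move: i1; rewrite (eq_measure_integral (law P (mX k)))// => A mA _.
exact/esym/identX.
Qed.

Lemma integrable_psum k : P.-integrable setT (EFin \o S k).
Proof.
elim: k => [|k IH].
  have -> : S 0 = cst 0 by apply/funext => w; rewrite /psum big_ord0.
  exact: finite_measure_integrable_cst.
have := integrableD measurableT IH (integrable_X k).
by congr integrable; apply/funext => w /=; rewrite psumS EFinD.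
Qed.

Lemma psum_X_indep k (A B : set R) : measurable A -> measurable B ->
  P (S k @^-1` A `&` X k @^-1` B) = (P (S k @^-1` A) * P (X k @^-1` B))%E.
Proof.
move=> mA mB; have := psum_indep mX mN indepX k 1 setT mA (fun=> mB).
by rewrite preimage_setT setTI probability_setT mul1e big_ord1 II1 bigcap_set1 addn0.
Qed.

(** [X k] is independent of the partial sum and has law [mu], so it can be integrated out first. *)
Lemma psum_step k (g : R * R -> R) : measurable_fun setT g ->
  (law P (mS k) \x mu)%E.-integrable setT (EFin \o g) ->
  (forall s, mu.-integrable setT (EFin \o (fun x => g (s, x)))) ->
  P.-integrable setT (EFin \o (fun w => g (S k w, X k w))) /\
  \int[P]_w g (S k w, X k w) = \int[P]_w \int[mu]_x g (S k w, x).
Proof.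
move=> mg ig ig2.
have eqm (A : set (R * R)) : measurable A ->
    (law P (mS k) \x law P (mX k))%E A = (law P (mS k) \x mu)%E A.
  move=> mA; apply: (@product_measure_unique _ _ _ _ _ (law P (mS k))
    (law P (mX k)) (law P (mS k) \x mu)%E) => // A' B' mA' mB'.
  rewrite [LHS](product_measure1E (law P (mS k)) mu mA' mB').
  by congr (_ * _)%E; exact/esym/identX.
have ig' : (law P (mS k) \x law P (mX k))%E.-integrable setT (EFin \o g).
  case/integrableP: ig => m1 i1; apply/integrableP; split; first exact: m1.
  by rewrite (eq_measure_integral (law P (mS k) \x mu)%E)// => A mA _; exact: eqm.
have igw := (indep_integrable (mS k) (mX k) (@psum_X_indep k) mg).2 ig'.
split => //.
rewrite (indep_Rintegral (mS k) (mX k) (@psum_X_indep k) mg igw).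
transitivity (\int[(law P (mS k) \x mu)%E]_z g z).
  by congr fine; apply: eq_measure_integral => A mA _; exact: eqm.
rewrite Rintegral_prod_snd//.
rewrite (Rintegral_law (mS k) (measurable_Rintegral_snd ig ig2))//.
apply/(integrable_law P (mS k) (measurable_Rintegral_snd ig ig2)).
exact: integrable_Rintegral_snd.
Qed.

(** Given that the partial sum of length k equals s, these are the conditional means of f(S) and of
    X f(S), where X is the next summand and S the next partial sum. *)
Definition shift_mean (f : R -> R) s : R := \int[mu]_x f (s + x).
Definition shift_moment (f : R -> R) s : R := \int[mu]_x (x * f (s + x)).
Definition abs_mean : R := \int[mu]_x `|x|.

Lemma integrable_abs_lawX : mu.-integrable setT (EFin \o (fun x : R => `|x|)).
Proof.
apply: (@integrable_dominated _ _ _ mu _ id 1) => //; first exact: integrable_lawX.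
by move=> w; rewrite normr_id mul1r.
Qed.

Section bounded_function.
Context (f : R -> R) (C : R) (mf : measurable_fun setT f) (fC : forall x, `|f x| <= C).

Lemma measurable_shift (s : R) : measurable_fun setT (fun x : R => f (s + x)).
Proof. by apply: (measurableT_comp mf); exact: measurable_funD. Qed.

Lemma integrable_shift s : mu.-integrable setT (EFin \o (fun x : R => f (s + x))).
Proof. by apply: (bounded_integrable mu (measurable_shift s)) => x; exact: fC. Qed.

Lemma integrable_shift_moment s :
  mu.-integrable setT (EFin \o (fun x : R => x * f (s + x))).
Proof.
apply: (@integrable_dominated _ _ _ mu _ id C) => //; last 2 first.
- exact: integrable_lawX.
- by move=> x; rewrite normrM mulrC ler_wpM2r.
by apply: measurable_funM => //; exact: measurable_shift.
Qed.

Context (nu : probability R R).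

Lemma integrable_prod_shift :
  (nu \x mu)%E.-integrable setT (EFin \o (fun z => f (z.1 + z.2))).
Proof. by apply: (bounded_integrable _ (measurable_addz mf)) => z; exact: fC. Qed.

Lemma integrable_prod_shift_moment :
  (nu \x mu)%E.-integrable setT (EFin \o (fun z => z.2 * f (z.1 + z.2))).
Proof. exact: (integrable_joint_add nu integrable_lawX mf fC). Qed.

Lemma measurable_shift_mean : measurable_fun setT (shift_mean f).
Proof. exact: (measurable_Rintegral_snd integrable_prod_shift integrable_shift). Qed.

Lemma measurable_shift_moment : measurable_fun setT (shift_moment f).
Proof.
exact: (measurable_Rintegral_snd integrable_prod_shift_moment integrable_shift_moment).
Qed.

Lemma shift_mean_le s : `|shift_mean f s| <= C.
Proof.
apply: (le_trans (le_normr_Rintegral measurableT (integrable_shift s))).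
rewrite -[leRHS](Rintegral_prob_cst mu); apply: le_Rintegral => //.
- apply: (@integrable_dominated _ _ _ mu _ (fun x => f (s + x)) 1).
  + by apply: measurableT_comp => //; exact: measurable_shift.
  + exact: integrable_shift.
  + by move=> x; rewrite normr_id mul1r.
- exact: finite_measure_integrable_cst.
Qed.

Lemma shift_moment_le s : `|shift_moment f s| <= C * abs_mean.
Proof.
apply: (le_trans (le_normr_Rintegral measurableT (integrable_shift_moment s))).
rewrite -RintegralZl//; last exact: integrable_abs_lawX.
apply: le_Rintegral => //.
- apply: (@integrable_dominated _ _ _ mu _ (fun x => x * f (s + x)) 1).
  + apply: measurableT_comp => //; apply: measurable_funM => //.
    exact: measurable_shift.
  + exact: integrable_shift_moment.
  + by move=> x; rewrite normr_id mul1r.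
- have := integrableZl measurableT C integrable_abs_lawX.
  by congr integrable; apply/funext => x /=; rewrite EFinM.
- by move=> x _; rewrite normrM mulrC ler_wpM2r.
Qed.

Lemma integrable_prod_fst_shift : nu.-integrable setT (EFin \o (fun s : R => s)) ->
  (nu \x mu)%E.-integrable setT (EFin \o (fun z => z.1 * f (z.1 + z.2))).
Proof.
move=> inu.
have i1 := integrable_prodM inu (finite_measure_integrable_cst mu 1 measurableT).
apply: (integrable_dominated (C := C) _ i1).
  by apply: measurable_funM; [exact: measurable_fst|exact: measurable_addz].
by move=> z /=; rewrite mulr1 normrM mulrC ler_wpM2r.
Qed.

End bounded_function.

Section psum_moments.
Context (f : R -> R) (C : R) (mf : measurable_fun setT f) (fC : forall x, `|f x| <= C).

Lemma Rintegral_psumS k : \int[P]_w f (S k.+1 w) = \int[P]_w shift_mean f (S k w).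
Proof.
have [_ <-] := psum_step (measurable_addz mf)
  (integrable_prod_shift mf fC (law P (mS k))) (integrable_shift mf fC).
by apply: eq_Rintegral => w _; rewrite psumS.
Qed.

Lemma Rintegral_psumS_mul k : \int[P]_w (S k.+1 w * f (S k.+1 w)) =
  \int[P]_w (S k w * shift_mean f (S k w)) + \int[P]_w shift_moment f (S k w).
Proof.
have inu : (law P (mS k)).-integrable setT (EFin \o (fun s : R => s)).
  by apply/integrable_law => //; exact: integrable_psum.
have m1 : measurable_fun setT (fun z : R * R => z.1 * f (z.1 + z.2)).
  by apply: measurable_funM; [exact: measurable_fst|exact: measurable_addz].
have m2 : measurable_fun setT (fun z : R * R => z.2 * f (z.1 + z.2)).
  by apply: measurable_funM; [exact: measurable_snd|exact: measurable_addz].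
have i1 s : mu.-integrable setT (EFin \o (fun x => s * f (s + x))).
  have := integrableZl measurableT s (integrable_shift mf fC s).
  by congr integrable; apply/funext => x /=; rewrite EFinM.
have [ig1 e1] := psum_step m1 (integrable_prod_fst_shift mf fC inu) i1.
have [ig2 e2] := psum_step m2 (integrable_prod_shift_moment mf fC (law P (mS k)))
  (integrable_shift_moment mf fC).
transitivity (\int[P]_w (S k w * f (S k w + X k w) + X k w * f (S k w + X k w))).
  by apply: eq_Rintegral => w _; rewrite psumS mulrDl.
rewrite RintegralD// e1 e2; congr (_ + _).
by apply: eq_Rintegral => w _; rewrite RintegralZl//; exact: integrable_shift.
Qed.

(* Fubini: both sides average [x * f (s + x + y)] over [mu \x mu]. *)
Lemma shift_comm s : shift_moment (shift_mean f) s = shift_mean (shift_moment f) s.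
Proof.
pose g (z : R * R) := z.2 * f (s + z.1 + z.2).
have mg : measurable_fun setT g.
  apply: measurable_funM; first exact: measurable_snd.
  apply: (measurableT_comp mf); apply: measurable_funD; last exact: measurable_snd.
  by apply: measurable_funD => //; exact: measurable_fst.
have ig : (mu \x mu)%E.-integrable setT (EFin \o g).
  apply: (@integrable_joint_dom _ mu mu g id C) => //; first exact: integrable_lawX.
  by move=> z; rewrite normrM mulrC ler_wpM2r.
have ig2 x : mu.-integrable setT (EFin \o (fun y => g (x, y))).
  exact: (integrable_shift_moment mf fC (s + x)).
rewrite /shift_mean -[RHS]/(\int[mu]_x \int[mu]_y g (x, y)) -Rintegral_prod_snd//.
rewrite /Rintegral -(integral21_prod_meas1 ig); congr fine.
apply: eq_integral => y _.
rewrite /fubini_G /= /g /= /shift_mean.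
rewrite [X in (_ * X)%:E](_ : _ = \int[mu]_x f (s + x + y)); last first.
  by apply: eq_Rintegral => x _; rewrite addrAC.
have isy : mu.-integrable setT (EFin \o (fun x : R => f (s + x + y))).
  apply: (@bounded_integrable _ _ _ mu _ C) => //.
  apply: (measurableT_comp mf); apply: measurable_funD => //.
  exact: measurable_funD.
rewrite EFinM /Rintegral fineK; last exact: (integrable_fin_num measurableT isy).
by rewrite -integralZl.
Qed.

End psum_moments.

(** Exchangeability says that each summand contributes equally. The induction obtains this by
    integrating out the last summand: the hypothesis is applied to [shift_mean f], hence the
    generality in [f], and [shift_comm] restores the missing summand. *)
Lemma Rintegral_psum_stein (f : R -> R) (C : R) k :
  measurable_fun setT f -> (forall x, `|f x| <= C) ->
  \int[P]_w (S k.+1 w * f (S k.+1 w)) = k.+1%:R * \int[P]_w shift_moment f (S k w).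
Proof.
elim: k f C => [|k IH] f C mf fC; rewrite (Rintegral_psumS_mul mf fC).
  rewrite mul1r (_ : \int[P]_w (S 0 w * _) = 0) ?add0r//.
  rewrite -[RHS](Rintegral_prob_cst P); apply: eq_Rintegral => w _.
  by rewrite /psum big_ord0 mul0r.
rewrite (IH _ C); [|exact: (measurable_shift_mean mf fC mu)|exact: shift_mean_le].
have -> : \int[P]_w shift_moment (shift_mean f) (S k w) =
          \int[P]_w shift_moment f (S k.+1 w).
  rewrite (Rintegral_psumS (measurable_shift_moment mf fC mu) (shift_moment_le mf fC)).
  by apply: eq_Rintegral => w _; exact: shift_comm.
by rewrite -[k.+2]addn1 natrD mulrDl mul1r.
Qed.

Local Notation W := (random_sum X N).
Local Notation p := (poisson_pmf lam).
Local Notation at_ n := (fun w => (N w == n)%:R : R).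
Local Notation below K := (fun w => (N w < K)%N%:R : R).

Lemma measurable_nat_comp (g : nat -> R) : measurable_fun setT (g \o N).
Proof. by apply: measurableT_comp. Qed.

Lemma measurable_random_sum : measurable_fun setT W.
Proof.
move=> _ B mB; rewrite setTI.
have -> : W @^-1` B = \bigcup_n (N @^-1` [set n] `&` S n @^-1` B).
  apply/seteqP; split => [w Bw|w [n _ [/= <-]]//].
  by exists (N w).
apply: bigcup_measurable => n _; apply: measurableI; first exact: measurable_N_event.
by rewrite -[X in measurable X]setTI; exact: mS.
Qed.

Lemma Rintegral_at n : \int[P]_w at_ n w = p n.
Proof.
have e : (fun w => at_ n w) = \1_(N @^-1` [set n]).
  apply/funext => w; rewrite indicE; congr (_%:R); congr nat_of_bool.
  by apply/idP/idP => [/eqP h|/set_mem /= ->//]; rewrite mem_set.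
rewrite e Rintegral_indic; last exact: measurable_N_event.
by rewrite poissonN.
Qed.

Lemma psum_at_indep n (A B : set R) : measurable A -> measurable B ->
  P (S n @^-1` A `&` (at_ n) @^-1` B) = (P (S n @^-1` A) * P ((at_ n) @^-1` B))%E.
Proof.
move=> mA mB.
have := psum_indep mX mN indepX n 0 [set k | B ((k == n)%:R)] mA (fun=> mB).
by rewrite II0 bigcap_set0 setIT big_ord0 mule1 setIC muleC.
Qed.

(** On the event N = n the random sum is [S n], which is independent of that event. *)
Lemma Rintegral_mul_at (h : R -> R) n : measurable_fun setT h ->
  P.-integrable setT (EFin \o (h \o S n)) ->
  P.-integrable setT (EFin \o (fun w => h (W w) * at_ n w)) /\
  \int[P]_w (h (W w) * at_ n w) = p n * \int[P]_w h (S n w).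
Proof.
move=> mh ih.
have mat : measurable_fun setT (at_ n) := measurable_nat_comp (fun k => (k == n)%:R).
have iat : P.-integrable setT (EFin \o (id \o at_ n)).
  apply: (@bounded_integrable _ _ _ P _ 1) => // w.
  by rewrite /=; case: eqP; rewrite ?normr1 ?normr0.
have [i1 e1] := indep_Rintegral_mul (mS n) mat (@psum_at_indep n) mh (@measurable_id _ _ setT) ih iat.
have E w : h (W w) * at_ n w = h (S n w) * at_ n w.
  by case: (eqVneq (N w) n) => [<-//|]; rewrite !mulr0.
split.
  by move: i1; congr integrable; apply/funext => w /=; rewrite E.
rewrite mulrC -Rintegral_at -e1.
by apply: eq_Rintegral => w _; rewrite E.
Qed.

Lemma belowS K w : below K.+1 w = below K w + at_ K w.
Proof. by rewrite /= ltnS; case: ltngtP => _; rewrite ?addr0 ?add0r. Qed.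

Lemma Rintegral_mul_below (h : R -> R) K : measurable_fun setT h ->
  (forall n, P.-integrable setT (EFin \o (h \o S n))) ->
  P.-integrable setT (EFin \o (fun w => h (W w) * below K w)) /\
  \int[P]_w (h (W w) * below K w) = \sum_(n < K) p n * \int[P]_w h (S n w).
Proof.
move=> mh ih; elim: K => [|K [i1 e1]].
  have E w : h (W w) * below 0%N w = 0 by rewrite mulr0.
  split.
    have := finite_measure_integrable_cst P (0 : R) measurableT.
    by congr integrable; apply/funext => w /=; rewrite E.
  rewrite big_ord0 -[RHS](Rintegral_prob_cst P).
  by apply: eq_Rintegral => w _; rewrite E.
have [i2 e2] := Rintegral_mul_at mh (ih K).
have E w : h (W w) * below K.+1 w = h (W w) * below K w + h (W w) * at_ K w.
  by rewrite belowS mulrDr.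
split.
  have := integrableD measurableT i1 i2.
  by congr integrable; apply/funext => w /=; rewrite E EFinD.
rewrite big_ord_recr/= -e1 -e2 -RintegralD//.
by apply: eq_Rintegral => w _; rewrite E.
Qed.

Lemma below_ge0 K w : 0 <= below K w. Proof. exact: ler0n. Qed.

Lemma below_le1 K w : below K w <= 1. Proof. by rewrite /= lern1 leq_b1. Qed.

Lemma below_near1 w : \forall K \near \oo, below K w = 1.
Proof. by exists (N w).+1 => // K /= NK; rewrite NK. Qed.

Lemma measurable_mul_below (G : T -> R) K : measurable_fun setT G ->
  measurable_fun setT (fun w => G w * below K w).
Proof.
move=> mG; apply: measurable_funM => //.
exact: (measurable_nat_comp (fun n => (n < K)%N%:R)).
Qed.

Lemma Rintegral_below_cvg (G : T -> R) : P.-integrable setT (EFin \o G) ->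
  \int[P]_w (G w * below K w) @[K --> \oo] --> \int[P]_w G w.
Proof.
move=> iG; have mG : measurable_fun setT G.
  by apply/measurable_EFinP; exact: measurable_int iG.
have mGb K : measurable_fun setT (fun w => (G w * below K w)%:E).
  by apply/measurable_EFinP; exact: measurable_mul_below.
have h1 : {ae P, forall w, setT w ->
    (fun K => (G w * below K w)%:E) @ \oo --> (EFin \o G) w}.
  apply: aeW => w _; apply: cvg_near_cst.
  by apply: filterS (below_near1 w) => K /= ->; rewrite mulr1.
have h2 : P.-integrable setT (fun w => `|G w|%:E) by exact: (integrable_abse iG).
have h3 : {ae P, forall w K, setT w -> (`|(G w * below K w)%:E| <= `|G w|%:E)%E}.
  apply: aeW => w K _; rewrite lee_fin normrM (ger0_norm (below_ge0 K w)).
  by rewrite ler_piMr// below_le1.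
have [_ _ h] := dominated_convergence measurableT mGb (measurable_int _ iG) h1 h2 h3.
apply: fine_cvg; rewrite fineK; first exact: h.
exact: (integrable_fin_num measurableT iG).
Qed.

Lemma Rintegral_abs_X k : \int[P]_w `|X k w| = abs_mean.
Proof.
have ia : P.-integrable setT (EFin \o (normr \o X k)).
  have := integrable_abse (integrable_X k).
  by congr integrable; apply/funext.
rewrite -(Rintegral_law (mX k) (@normr_measurable R setT) ia).
by congr fine; apply: eq_measure_integral => A mA _; exact: identX.
Qed.

Lemma integrable_abs_fun (G : T -> R) : P.-integrable setT (EFin \o G) ->
  P.-integrable setT (EFin \o (fun w => `|G w|)).
Proof.
by move=> /integrable_abse; congr integrable; apply/funext.
Qed.

Lemma Rintegral_abs_psum k : \int[P]_w `|S k w| <= k%:R * abs_mean.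
Proof.
elim: k => [|k IH].
  rewrite mul0r -[leRHS](Rintegral_prob_cst P) le_eqVlt; apply/orP; left; apply/eqP.
  by apply: eq_Rintegral => w _; rewrite /psum big_ord0 normr0.
have i1 := integrable_abs_fun (integrable_psum k).
have i2 := integrable_abs_fun (integrable_X k).
apply: (@le_trans _ _ (\int[P]_w (`|S k w| + `|X k w|))).
  apply: le_Rintegral => //.
  - exact: integrable_abs_fun (integrable_psum k.+1).
  - have := integrableD measurableT i1 i2.
    by congr integrable; apply/funext => w /=; rewrite EFinD.
  - by move=> w _; rewrite psumS ler_normD.
by rewrite RintegralD// Rintegral_abs_X -addn1 natrD mulrDl mul1r lerD2r.
Qed.

Lemma sum_poisson_le1 K : \sum_(n < K) p n <= 1.
Proof.
have i1 n : P.-integrable setT (EFin \o (cst (1 : R) \o S n)).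
  exact: finite_measure_integrable_cst.
have [ib e] := Rintegral_mul_below K (measurable_cst (1 : R)) i1.
rewrite (_ : \sum_(n < K) p n = \sum_(n < K) p n * \int[P]_w cst 1 (S n w)); last first.
  by apply: eq_bigr => n _; rewrite (Rintegral_prob_cst P) mulr1.
rewrite -e -[leRHS](Rintegral_prob_cst P); apply: le_Rintegral => //.
  exact: finite_measure_integrable_cst.
by move=> w _; rewrite mul1r below_le1.
Qed.

(** Source of the factor [lam] in (S): it absorbs the factor [n.+1] of [Rintegral_psum_stein]. *)
Lemma poisson_pmfS n : p n.+1 * n.+1%:R = lam * p n.
Proof.
rewrite /poisson_pmf lam0 factS exprS natrM invfM.
have n0 : n.+1%:R != 0 :> R by rewrite pnatr_eq0.
have f0 : n`!%:R != 0 :> R by rewrite pnatr_eq0 -lt0n fact_gt0.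
move: (n.+1%:R : R) (n`!%:R : R) n0 f0 => a b a0 b0.
by field; rewrite a0 b0.
Qed.

Lemma Rintegral_abs_below K : \int[P]_w (`|W w| * below K w) <= lam * abs_mean.
Proof.
have ia n : P.-integrable setT (EFin \o (normr \o S n)).
  exact: integrable_abs_fun (integrable_psum n).
have [_ ->] := Rintegral_mul_below K (@normr_measurable R setT) ia.
have M0 : 0 <= abs_mean by apply: Rintegral_ge0.
have h n : p n * \int[P]_w `|S n w| <= (p n * n%:R) * abs_mean.
  by rewrite -mulrA ler_wpM2l ?poisson_pmf_ge0// Rintegral_abs_psum.
case: K => [|K]; first by rewrite big_ord0 mulr_ge0// ltW.
rewrite big_ord_recl.
have := h 0%N; rewrite mulr0 mul0r => h0.
apply: (@le_trans _ _ (\sum_(n < K) lam * p n * abs_mean)).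
  rewrite -[leRHS]add0r lerD//; apply: ler_sum => n _.
  by rewrite (le_trans (h _))// poisson_pmfS.
rewrite -mulr_suml -mulr_sumr -mulrA ler_wpM2l ?(ltW lam0)//.
by rewrite ler_piMl// sum_poisson_le1.
Qed.

(** The bound of [Rintegral_abs_below] does not depend on [K], so monotone convergence applies. *)
Lemma integrable_random_sum : P.-integrable setT (EFin \o W).
Proof.
have mW := measurable_random_sum.
have maW : measurable_fun setT (fun w => `|W w|) by exact: measurableT_comp.
apply/integrableP; split; first exact/measurable_EFinP.
have ia n : P.-integrable setT (EFin \o (normr \o S n)).
  exact: integrable_abs_fun (integrable_psum n).
have lim : (\int[P]_w (`|W w| * below K w)%:E)%E @[K --> \oo] --> (\int[P]_w `|W w|%:E)%E.
  have le w : (`|W w|%:E = limn (fun K => (`|W w| * below K w)%:E))%E.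
    apply/esym/cvg_lim => //; apply: cvg_near_cst.
    by apply: filterS (below_near1 w) => K /= ->; rewrite mulr1.
  under eq_integral do rewrite le.
  apply: cvg_monotone_convergence => //.
  - by move=> K; apply/measurable_EFinP; exact: measurable_mul_below.
  - move=> w _ K K' KK'; rewrite lee_fin ler_wpM2l// ler_nat.
    by case: (ltnP (N w) K) => // h; rewrite (leq_trans h).
have : (\int[P]_w `|W w|%:E <= (lam * abs_mean)%:E)%E.
  rewrite -(cvg_lim _ lim)//; apply: lime_le; first by apply/cvg_ex; eexists; exact: lim.
  apply: nearW => K.
  have [iK _] := Rintegral_mul_below K (@normr_measurable R setT) ia.
  by rewrite -(fineK (integrable_fin_num measurableT iK)) lee_fin Rintegral_abs_below.
by move=> /le_lt_trans; apply; exact: ltry.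
Qed.

(** The identities for fixed length are summed with Poisson weights up to a cut-off [K], where the
    sums are finite; dominated convergence removes the cut-off. *)
Lemma compound_poisson_stein (f : R -> R) (C : R) :
  measurable_fun setT f -> (forall x, `|f x| <= C) ->
  \int[P]_w (W w * f (W w)) = lam * \int[P]_w shift_moment f (W w).
Proof.
move=> mf fC.
have mW := measurable_random_sum.
have midf : measurable_fun setT (fun x : R => x * f x) by exact: measurable_funM.
have mB := measurable_shift_moment mf fC mu.
have iSf n : P.-integrable setT (EFin \o ((fun x : R => x * f x) \o S n)).
  apply: (@integrable_dominated _ _ _ P _ (S n) C) => //.
  - exact: (measurableT_comp midf (mS n)).
  - exact: integrable_psum.
  - by move=> w; rewrite /= normrM mulrC ler_wpM2r.
have iB n : P.-integrable setT (EFin \o (shift_moment f \o S n)).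
  apply: (@bounded_integrable _ _ _ P _ (C * abs_mean)).
    exact: (measurableT_comp mB (mS n)).
  by move=> w; exact: shift_moment_le.
have iWf : P.-integrable setT (EFin \o (fun w => W w * f (W w))).
  apply: (@integrable_dominated _ _ _ P _ W C) => //.
  - exact: (measurableT_comp midf mW).
  - exact: integrable_random_sum.
  - by move=> w; rewrite /= normrM mulrC ler_wpM2r.
have iBW : P.-integrable setT (EFin \o (fun w => shift_moment f (W w))).
  apply: (@bounded_integrable _ _ _ P _ (C * abs_mean)).
    exact: (measurableT_comp mB mW).
  by move=> w; exact: shift_moment_le.
(* The term n = 0 vanishes because [S 0] is zero, and the Poisson recursion lowers the index by one;
   hence [K.+1] against [K]. *)
have e K : \int[P]_w (W w * f (W w) * below K.+1 w) =
    lam * \int[P]_w (shift_moment f (W w) * below K w).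
  have [_ ->] := Rintegral_mul_below K.+1 midf iSf.
  have [_ ->] := Rintegral_mul_below K mB iB.
  rewrite big_ord_recl (_ : \int[P]_w (S 0 w * _) = 0); last first.
    rewrite -[RHS](Rintegral_prob_cst P); apply: eq_Rintegral => w _.
    by rewrite /psum big_ord0 mul0r.
  rewrite mulr0 add0r mulr_sumr; apply: eq_bigr => n _.
  by rewrite (Rintegral_psum_stein _ mf fC) !mulrA poisson_pmfS.
have l1 := Rintegral_below_cvg iWf.
have l2 : lam * \int[P]_w (shift_moment f (W w) * below K w) @[K --> \oo] -->
    lam * \int[P]_w shift_moment f (W w).
  by apply: cvgMr; exact: Rintegral_below_cvg iBW.
have l1' : \int[P]_w (W w * f (W w) * below K.+1 w) @[K --> \oo] --> \int[P]_w (W w * f (W w)).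
  by rewrite (cvg_shiftS (fun K => \int[P]_w (W w * f (W w) * below K w))).
have E : (fun K => \int[P]_w (W w * f (W w) * below K.+1 w)) =
    (fun K => lam * \int[P]_w (shift_moment f (W w) * below K w)).
  by apply/funext => K; exact: e.
by rewrite E in l1'; exact: (cvg_unique (@norm_hausdorff _ R) l1' l2).
Qed.

End compound_sum.

(** * One-sided bound for normalised Poisson sums *)

Section one_sided_bound.
Context d (T : measurableType d) (R : realType) (P : probability T R)
  (X : nat -> T -> R) (N : T -> nat) (lam : R).
Context (mX : forall i, measurable_fun setT (X i)) (mN : measurable_fun setT N)
  (identX : ident_distr P X) (indepX : indep_N_Xs P N X)
  (iX : P.-integrable setT (EFin \o X 0%N)) (lam0 : 0 < lam)
  (poissonN : poisson_rv P lam N)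
  (iX2 : P.-integrable setT (EFin \o (fun w => X 0%N w ^+ 2)))
  (meanX : \int[P]_w X 0%N w = 0) (varX : lam * \int[P]_w X 0%N w ^+ 2 = 1).
Local Notation W := (random_sum X N).
Let L := lam * \int[P]_w lyapunov_weight (X 0%N w).

Lemma random_sum_cdf_le x :
  fine (P (W @^-1` `]-oo, x])) <= ncdf x + 18546 / 10000 * L.
Proof.
have lam0' := lam0.
have mW := measurable_random_sum mX mN.
have iW := integrable_random_sum mX mN identX indepX iX lam0 poissonN.
pose mu := law P (mX 0%N); pose rho := law P mW.
have mid : measurable_fun setT (@id R) by exact: measurable_id.
have m2 : measurable_fun setT (fun x : R => x ^+ 2) by exact: measurable_funX.
have imu : mu.-integrable setT (EFin \o (fun x : R => x)) by exact: (integrable_law P _ mid).1.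
have irho : rho.-integrable setT (EFin \o (fun x : R => x)) by exact: (integrable_law P mW mid).1.
have imu2 : mu.-integrable setT (EFin \o (fun x : R => x ^+ 2)) by exact: (integrable_law P _ m2).1.
have mean0 : \int[mu]_x x = 0 by rewrite -meanX; exact: (Rintegral_law _ mid).
have var1 : lam * \int[mu]_x x ^+ 2 = 1.
  by rewrite -varX; congr (_ * _); exact: (Rintegral_law _ m2).
have steinE (f : R -> R) (C : R) : measurable_fun setT f -> (forall x, `|f x| <= C) ->
    \int[rho]_w (w * f w) = lam * \int[(rho \x mu)%E]_z (z.2 * f (z.1 + z.2)).
  move=> mf fC.
  have midf : measurable_fun setT (fun x : R => x * f x) by exact: measurable_funM.
  have ig := integrable_prod_shift_moment mX iX mf fC rho.
  have ig2 := integrable_shift_moment mX iX mf fC.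
  have iWf : P.-integrable setT (EFin \o (fun w => W w * f (W w))).
    by apply/(integrable_law P mW midf); exact: (integrable_id_mul irho mf fC).
  rewrite (Rintegral_law mW midf iWf).
  rewrite (compound_poisson_stein mX mN identX indepX iX lam0 poissonN mf fC).
  rewrite (Rintegral_prod_snd ig ig2); congr (_ * _).
  have ms := measurable_shift_moment mX iX mf fC rho.
  rewrite -(Rintegral_law mW ms)//.
  apply/(integrable_law P mW ms); exact: (integrable_Rintegral_snd ig ig2).
have wE : lam * \int[mu]_x lyapunov_weight x = L.
  have mw := @measurable_weight R.
  rewrite /L; congr (_ * _); apply: (Rintegral_law _ mw).
  by apply/(integrable_law P (mX 0%N) mw); exact: integrable_weight.
have L0 : 0 <= L.
  by rewrite mulr_ge0 ?(ltW lam0)//; apply: Rintegral_ge0 => w _; exact: weight_ge0.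
have F1 : fine (P (W @^-1` `]-oo, x])) <= 1.
  have mP : measurable (W @^-1` `]-oo, x]).
    by rewrite -[X in measurable X]setTI; exact: (mW measurableT).
  by rewrite -lee_fin fineK ?fin_num_measure// probability_le1.
have n0 := ncdf_ge0 x.
have main l : 0 < l -> l <= 3 / 5 -> L <= l ->
    fine (P (W @^-1` `]-oo, x])) <= ncdf x + 7 / 4 * l.
  move=> l0 l1 Ll.
  apply: (@stein_cdf_le R rho mu lam) => //.
  by rewrite wE.
(* Beyond 3/5 the right-hand side exceeds 1. *)
have [L35|L35] := leP L (3 / 5); last by lra.
move: L0; rewrite le_eqVlt => /predU1P[L0|L0]; last first.
  by have := main L L0 L35 (lexx L); lra.
(* [stein_cdf_le] asks for a positive [l], so [L = 0] is treated with arbitrarily small [l]. *)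
rewrite -L0 mulr0 addr0; apply/ler_addgt0Pr => e e0.
have := main (Num.min (e / 2) (3 / 5)).
rewrite lt_min ge_min lexx orbT -L0 le_min.
have -> : 0 < e / 2 by lra.
have -> : 0 < 3 / 5 :> R by lra.
have -> : 0 <= e / 2 by lra.
have -> : 0 <= 3 / 5 :> R by lra.
move=> /(_ isT isT isT).
have : Num.min (e / 2) (3 / 5) <= e / 2 by rewrite ge_min lexx.
lra.
Qed.

End one_sided_bound.

(** * Normalisation and the two-sided bound *)

Section scaling.
Context d (T : measurableType d) (R : realType) (P : probability T R)
  (X : nat -> T -> R) (N : T -> nat) (c : R).
Let Y i w := c * X i w.

Let mscaled (B : set R) : measurable B -> measurable [set x : R | B (c * x)].
Proof.
move=> mB; rewrite -[X in measurable X]setTI.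
by apply: (measurable_funM (measurable_cst c) (@measurable_id _ _ setT)).
Qed.

Lemma ident_distr_scale : ident_distr P X -> ident_distr P Y.
Proof. by move=> h i B mB; exact: (h i _ (mscaled mB)). Qed.

Lemma indep_N_Xs_scale : indep_N_Xs P N X -> indep_N_Xs P N Y.
Proof.
by move=> h n A B mB; exact: (h n A (fun i => [set x | B i (c * x)]) (fun i => mscaled (mB i))).
Qed.

Lemma random_sum_scale w : random_sum Y N w = c * random_sum X N w.
Proof. by rewrite /random_sum mulr_sumr. Qed.

End scaling.
Theorem theorem7 (d : measure_display) (T : measurableType d) (R : realType)
  (P : probability T R) (X : nat -> T -> R) (N : T -> nat) (sigma lam : R) :
  (forall i, measurable_fun setT (X i)) ->
  measurable_fun setT N ->
  ident_distr P X ->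
  indep_N_Xs P N X ->
  P.-integrable setT (EFin \o X 0%N) ->
  ('E_P[X 0%N] = 0)%E ->
  0 < sigma ->
  ('E_P[fun w => (X 0%N w ^+ 2)%R] = (sigma ^+ 2)%:E)%E ->
  0 < lam ->
  poisson_rv P lam N ->
  forall x : R,
    (`| P [set w | (random_sum X N w < x * sigma * Num.sqrt lam)%R] - Phi x |
     <= ((18546%:R / 10000%:R) / sigma ^+ 2)%:E *
        'E_P[fun w => (X 0%N w ^+ 2 *
                      Num.min 1 (`|X 0%N w| / (sigma * Num.sqrt lam)))%R])%E.
Proof.
move=> mX mN identX indepX iX meanX sigma0 varX lam0 poissonN x.
rewrite unlock in meanX varX; rewrite unlock.
pose s := sigma * Num.sqrt lam.
have sl0 : 0 < Num.sqrt lam by rewrite sqrtr_gt0.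
have s0 : 0 < s by rewrite mulr_gt0.
have s2 : s ^+ 2 = sigma ^+ 2 * lam by rewrite exprMn sqr_sqrtr// ltW.
have mX2 : measurable_fun setT (fun w => X 0%N w ^+ 2) by exact: measurable_funX.
have iX2 : P.-integrable setT (EFin \o (fun w => X 0%N w ^+ 2)).
  apply/integrableP; split; first exact/measurable_EFinP.
  (* The square is its own absolute value, so [varX] already gives the finite integral. *)
  rewrite (eq_integral (fun w => (X 0%N w ^+ 2)%:E)) ?varX ?ltry// => w _.
  by rewrite /= ger0_norm ?sqr_ge0.
have meanX' : \int[P]_w X 0%N w = 0 by rewrite /Rintegral meanX.
have varX' : \int[P]_w X 0%N w ^+ 2 = sigma ^+ 2 by rewrite /Rintegral varX.
pose h w := X 0%N w ^+ 2 * Num.min 1 (`|X 0%N w| / s).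
have h0 w : 0 <= h w.
  by rewrite mulr_ge0 ?sqr_ge0// le_min ler01 divr_ge0// ltW.
have ih : P.-integrable setT (EFin \o h).
  apply: (@integrable_dominated _ _ _ P _ (fun w => X 0%N w ^+ 2) 1) => //.
    apply: measurable_funM => //; apply: measurable_minr => //.
    by apply: measurable_funM => //; exact: measurableT_comp.
  move=> w; rewrite mul1r (ger0_norm (h0 w)) ger0_norm ?sqr_ge0//.
  by rewrite ler_piMr ?sqr_ge0// ge_min lexx.
pose L := (\int[P]_w h w) / sigma ^+ 2.
(* Fixing only the absolute value of [c] covers the normalised sum and its negative at once. The
   factor [1 / s ^+ 2] times [lam] leaves the [1 / sigma ^+ 2] in [L]. *)
have bound c : `|c| = s^-1 -> forall y,
    fine (P ((fun w => c * random_sum X N w) @^-1` `]-oo, y])) <= ncdf y + 18546 / 10000 * L.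
  move=> cs y.
  have c2 : c ^+ 2 = (s ^+ 2)^-1 by rewrite -real_normK ?num_real// cs exprVn.
  have sn0 : sigma != 0 by rewrite gt_eqF.
  have ln0 : lam != 0 by rewrite gt_eqF.
  have := @random_sum_cdf_le _ _ _ P (fun i w => c * X i w) N lam _ mN
    (ident_distr_scale c identX) (indep_N_Xs_scale c indepX) _ lam0 poissonN _ _ _ y.
  rewrite (_ : random_sum _ N = (fun w => c * random_sum X N w)); last first.
    by apply/funext => w; exact: random_sum_scale.
  have wE w : lyapunov_weight (c * X 0%N w) = c ^+ 2 * h w.
    by rewrite /lyapunov_weight /h exprMn normrM cs (mulrC s^-1) -mulrA.
  rewrite (_ : lam * \int[P]_w lyapunov_weight (c * X 0%N w) = L); last first.
    under eq_Rintegral do rewrite wE.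
    by rewrite RintegralZl// c2 s2 /L; field; rewrite sn0 ln0.
  apply.
  - by move=> i; exact: measurable_funM.
  - have := integrableZl measurableT c iX.
    by congr integrable; apply/funext => w /=; rewrite EFinM.
  - have := integrableZl measurableT (c ^+ 2) iX2.
    by congr integrable; apply/funext => w /=; rewrite exprMn EFinM.
  - by rewrite RintegralZl// meanX' mulr0.
  - under eq_Rintegral do rewrite exprMn.
    by rewrite RintegralZl// varX' c2 s2; field; rewrite sn0 ln0.
have mW := measurable_random_sum mX mN.
have sV0 : 0 < s^-1 by rewrite invr_gt0.
have cV : `|s^-1| = s^-1 by rewrite ger0_norm// ltW.
have mpre c y : measurable ((fun w => c * random_sum X N w) @^-1` `]-oo, y]).
  rewrite -[X in measurable X]setTI.
  exact: (measurable_funM (measurable_cst c) mW measurableT).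
pose E := [set w | random_sum X N w < x * sigma * Num.sqrt lam].
have EE w : E w <-> s^-1 * random_sum X N w < x.
  by rewrite /E/= -mulrA -/s (mulrC s^-1) ltr_pdivrMr.
(* Negation exchanges strict and weak inequalities: the complement of [E] is exactly an event of the
   form covered by [bound], now for [- s^-1] and [- x]. For the upper bound, inclusion in the weak
   event suffices. *)
have EC : E = ~` ((fun w => - s^-1 * random_sum X N w) @^-1` `]-oo, - x]).
  apply/seteqP; split => w.
    by move=> /EE hw; rewrite /= in_itv/= mulNr lerN2; apply/negP; rewrite -ltNge.
  by rewrite /= in_itv/= mulNr lerN2 => /negP; rewrite -ltNge => hw; apply/EE.
have mE : measurable E by rewrite EC; exact: measurableC.
have up : fine (P E) <= ncdf x + 18546 / 10000 * L.
  apply: le_trans (bound _ cV x); rewrite fine_le ?fin_num_measure//.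
  by apply: le_measure; rewrite ?inE// => w /EE hw; rewrite /= in_itv/= ltW.
have low : ncdf x - 18546 / 10000 * L <= fine (P E).
  have := bound (- s^-1); rewrite normrN => /(_ cV (- x)); rewrite ncdfN.
  have mB := mpre (- s^-1) (- x); rewrite EC.
  have -> := probability_setC P mB.
  rewrite fineB; [|by []|exact: fin_num_measure mB].
  by move: (fine (P _)) (ncdf x) (_ * L) => F n b; clear; rewrite [fine 1]/=; lra.
rewrite -/E PhiE -(fineK (fin_num_measure P _ mE)) -EFinB abse_EFin.
rewrite (_ : (\int[P]_w (h w)%:E)%E = (\int[P]_w h w)%:E); last first.
  by rewrite /Rintegral fineK//; exact: (integrable_fin_num measurableT ih).
rewrite -EFinM lee_fin ler_distl.
have -> : 18546 / 10000 / sigma ^+ 2 * \int[P]_w h w = 18546 / 10000 * L.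
  by rewrite /L mulrAC mulrA.
by rewrite low up.
Qed.
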